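(* Let $g\in\mathbb{F}_q[t]$ be a non-constant square-free polynomial that is not a Carmichael polynomial. Then there exist infinitely many cyclotomic function fields $\mathbb{F}_q(t)(\Lambda_M)$ whose discriminants are relatively prime to $g$ such that $g$ is not Carmichael in them.
   Context: $\mathbb{F}_q$ is the finite field with $q$ elements. A finite ring $S$ is a Carmichael ring if $S$ is not a field and $a^{|S|}=a$ for every $a\in S$; an ideal $I$ of a ring $R$ is a Carmichael ideal if $R/I$ is a Carmichael ring. A polynomial $g\in\mathbb{F}_q[t]$ is a Carmichael polynomial if $(g)$ is a Carmichael ideal of $\mathbb{F}_q[t]$. For a finite extension $K$ of $\mathbb{F}_q(t)$, $\mathcal{O}_K$ denotes the integral closure of $\mathbb{F}_q[t]$ in $K$, and an element $\alpha\in\mathcal{O}_K$ is Carmichael in $K$ if $\alpha\mathcal{O}_K$ is a Carmichael ideal of $\mathcal{O}_K$. The discriminant of $K$ is the discriminant ideal of $\mathcal{O}_K$ over $\mathbb{F}_q[t]$; ''relatively prime to $g$'' means no irreducible factor of $g$ divides it. Cyclotomic function fields (Carlitz): let $\overline{\mathbb{F}_q(t)}$ be an algebraic closure and let $\rho:\mathbb{F}_q[t]\to\mathrm{End}_{\mathbb{F}_q}(\overline{\mathbb{F}_q(t)})$, $M\mapsto\rho_M$, be the $\mathbb{F}_q$-algebra homomorphism determined by $\rho_a(\alpha)=a\alpha$ for $a\in\mathbb{F}_q$ and $\rho_t(\alpha)=t\alpha+\alpha^q$. For a non-constant $M\in\mathbb{F}_q[t]$, $\Lambda_M=\{\alpha\in\overline{\mathbb{F}_q(t)}:\rho_M(\alpha)=0\}$,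 and $\mathbb{F}_q(t)(\Lambda_M)$ is the field generated by $\Lambda_M$ over $\mathbb{F}_q(t)$, called the $M$-th cyclotomic function field. *)

(* Defs.v *)
From HB Require Import structures.
From mathcomp Require Import all_boot all_order all_algebra all_field.
Set Implicit Arguments. Unset Strict Implicit. Unset Printing Implicit Defensive.
Import GRing.Theory.
Local Open Scope ring_scope.

(** * Carmichael ideals, for a principal ideal [a O] of a subring [O] of a
    commutative ring [R] (subring given as a predicate [O : R -> Prop]). *)

Definition cong (R : comNzRingType) (O : R -> Prop) (a x y : R) : Prop :=
  exists z, O z /\ x - y = a * z.

Definition quot_card (R : comNzRingType) (O : R -> Prop) (a : R) (N : nat) : Prop :=
  exists s : seq R,
    size s = N /\ (forall i, (i < N)%N -> O (nth 0 s i)) /\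
    (forall i j, (i < N)%N -> (j < N)%N -> i <> j ->
        ~ cong O a (nth 0 s i) (nth 0 s j)) /\
    (forall x, O x -> exists2 i, (i < N)%N & cong O a x (nth 0 s i)).

Definition quot_is_field (R : comNzRingType) (O : R -> Prop) (a : R) : Prop :=
  ~ cong O a 1 0 /\
  (forall x, O x -> ~ cong O a x 0 -> exists y, O y /\ cong O a (x * y) 1).

Definition carmichael_ideal (R : comNzRingType) (O : R -> Prop) (a : R) : Prop :=
  exists N, quot_card O a N /\ ~ quot_is_field O a /\
            (forall x, O x -> cong O a (x ^+ N) x).

Definition carmichael_poly (F : finFieldType) (g : {poly F}) : Prop :=
  carmichael_ideal (fun _ : {poly F} => True) g.

Definition squarefree_poly (F : finFieldType) (g : {poly F}) : Prop :=
  forall p : {poly F}, (1 < size p)%N -> ~ (p * p %| g).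

(** * Carlitz module and cyclotomic function fields inside an algebraically
    closed field [L] containing F_q[t] (via the injective morphism [phi]). *)

Definition carlitz_t (F : finFieldType) (L : closedFieldType)
  (phi : {rmorphism {poly F} -> L}) (x : L) : L :=
  phi 'X * x + x ^+ #|F|.

Definition carlitz (F : finFieldType) (L : closedFieldType)
  (phi : {rmorphism {poly F} -> L}) (M : {poly F}) (x : L) : L :=
  \sum_(i < size M) phi (M`_i)%:P * iter i (carlitz_t phi) x.

Definition subfield_closed (L : closedFieldType) (S : L -> Prop) : Prop :=
  S 1 /\ (forall x y, S x -> S y -> S (x - y)) /\
  (forall x y, S x -> S y -> S (x * y)) /\ (forall x, S x -> S x^-1).

Definition in_cyclo (F : finFieldType) (L : closedFieldType)
  (phi : {rmorphism {poly F} -> L}) (M : {poly F}) (x : L) : Prop :=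
  forall S : L -> Prop, subfield_closed S -> (forall a, S (phi a)) ->
    (forall l, carlitz phi M l = 0 -> S l) -> S x.

Definition integral_over_Fqt (F : finFieldType) (L : closedFieldType)
  (phi : {rmorphism {poly F} -> L}) (x : L) : Prop :=
  exists p : {poly {poly F}}, p \is monic /\ root (map_poly phi p) x.

Definition cyclo_ring (F : finFieldType) (L : closedFieldType)
  (phi : {rmorphism {poly F} -> L}) (M : {poly F}) (x : L) : Prop :=
  in_cyclo phi M x /\ integral_over_Fqt phi x.

Definition carmichael_in_cyclo (F : finFieldType) (L : closedFieldType)
  (phi : {rmorphism {poly F} -> L}) (M : {poly F}) (alpha : L) : Prop :=
  cyclo_ring phi M alpha /\ carmichael_ideal (cyclo_ring phi M) alpha.

(* The discriminant of K = F_q(t)(Lambda_M) (the discriminant ideal of O_K over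
   F_q[t], generated by det (Tr(b_i b_j)) for an F_q[t]-basis b of O_K) is
   relatively prime to g.  Here c i j k l is the l-th coordinate of
   b_i b_j b_k, so Tr_{K/F_q(t)}(b_i b_j) = sum_k c i j k k. *)
Definition disc_coprime (F : finFieldType) (L : closedFieldType)
  (phi : {rmorphism {poly F} -> L}) (M g : {poly F}) : Prop :=
  exists n (b : 'I_n -> L),
    (forall i, cyclo_ring phi M (b i)) /\
    (forall x, cyclo_ring phi M x ->
       exists a : 'I_n -> {poly F}, x = \sum_(i < n) phi (a i) * b i) /\
    (forall a : 'I_n -> {poly F}, \sum_(i < n) phi (a i) * b i = 0 ->
       forall i, a i = 0) /\
    exists c : 'I_n -> 'I_n -> 'I_n -> 'I_n -> {poly F},
      (forall i j k, b i * b j * b k = \sum_(l < n) phi (c i j k l) * b l) /\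
      (forall P : {poly F}, irreducible_poly P -> P %| g ->
         ~~ (P %| \det (\matrix_(i < n, j < n) \sum_(k < n) c i j k k))).

Definition same_cyclo (F : finFieldType) (L : closedFieldType)
  (phi : {rmorphism {poly F} -> L}) (M N : {poly F}) : Prop :=
  forall x, in_cyclo phi M x <-> in_cyclo phi N x.

(* Main.v *)
(** Let q = #|F|. Since [g] is square-free and not Carmichael, it has an irreducible factor [P]
    which either generates the same ideal as [g] or has a degree not dividing deg g. Suppose [P] is
    a primitive root modulo an irreducible [M] of large degree n, and put m = q^n - 1. Then [P] is
    inert in K = F(t)(Lambda_M), of degree m: the Frobenius of [P] acts on the [M]-torsion of the
    Carlitz module modulo [P] as rho_P, hence transitively on the nonzero torsion. If [g] is
    associated to [P], then O_K/g is a field. Otherwise, if [g] were Carmichael, all elements of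
    the field O_K/P, which has q^(m deg P) elements, would be fixed by the power q^(m deg g), so
    deg P would divide deg g. The ring O_K is generated by one torsion point lambda, and its
    discriminant divides a power of [M]; fields of different degrees are different.

    Infinitely many such [M] exist by Artin's conjecture for [P]. For a prime n the prime factors
    of q^n - 1 not dividing q - 1 exceed n, so few [M] of degree n have [P] as a residue of such an
    exponent; for the prime factors of q - 1, the condition is a congruence for [M] modulo [P] by
    reciprocity. A positive proportion of the irreducible polynomials of degree n lies in a given
    residue class modulo [P], because the inverse roots w of the L-polynomials satisfy |w| < q. To
    see this, note that the power sums of the w are bounded by q^n, strictly for infinitely many n;
    a root with |w| >= q would force the remaining ones, suitably rotated and completed by
    their conjugates, to have nonpositive power sums, which then must vanish eventually by Newton's
    identities. *)
Require Import Defs.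
From HB Require Import structures.
From mathcomp Require Import all_boot all_order all_fingroup all_algebra.
From mathcomp Require Import all_solvable all_field all_character.
From mathcomp Require Import qpoly qfpoly zify ring.
From Stdlib Require Import Classical_Prop.
Set Implicit Arguments. Unset Strict Implicit. Unset Printing Implicit Defensive.
Import Order.TTheory GRing.Theory Num.Theory.
Local Open Scope ring_scope.

(** * Power sums *)

(** The coefficientwise form of T h'(T) = S(T) h(T), where h(T) is the generating series of [h] and
    S(T) is the sum of the s_n T^n for n >= 1. So [s] lists the coefficients of the logarithmic
    derivative T h' / h. *)
Definition log_deriv (R : nzRingType) (h s : nat -> R) : Prop :=
  forall m, h m.+1 *+ m.+1 = \sum_(i < m.+1) s i.+1 * h (m - i)%N.

(** As h_0 = 1, the last term of each identity is the new value of [s], so the identities form a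
    recursion for it. *)
Lemma log_deriv_uniq (R : nzRingType) (h s s' : nat -> R) :
  h 0%N = 1 -> log_deriv h s -> log_deriv h s' -> forall n, s n.+1 = s' n.+1.
Proof.
move=> h0 hs hs' n; elim/ltn_ind: n => n IHn.
have := hs n; rewrite hs' !big_ord_recr /= subnn h0 !mulr1.
rewrite (eq_bigr (fun i : 'I_n => s i.+1 * h (n - i)%N)); first by move/addrI.
by move=> i _; rewrite IHn.
Qed.

(** Newton's identities: the logarithmic derivative of a product is the sum of those of its factors,
    and 1 - v T contributes minus the geometric series of v T. *)
Lemma newton_log_deriv (R : comNzRingType) (vs : seq R) :
  log_deriv (fun m => (\prod_(v <- vs) (1 - v *: 'X))`_m)
            (fun n => - \sum_(v <- vs) v ^+ n).
Proof.
elim: vs => [|v vs IHvs] m.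
  rewrite big_nil coef1 /= mul0rn big1 // => i _.
  by rewrite big_nil oppr0 mul0r.
pose h k := (\prod_(v <- vs) (1 - v *: 'X))`_k.
pose p k := \sum_(v <- vs) v ^+ k.
have hE k : (\prod_(w <- v :: vs) (1 - w *: 'X))`_k.+1 = h k.+1 - v * h k.
  by rewrite big_cons mulrBl mul1r coefB -scalerAl coefZ coefXM.
have h0 : (\prod_(w <- v :: vs) (1 - w *: 'X))`_0 = h 0%N.
  by rewrite big_cons mulrBl mul1r coefB -scalerAl coefZ coefXM mulr0 subr0.
rewrite hE big_ord_recr /= subnn h0.
under eq_bigr => i _.
  rewrite -(subnSK (ltn_ord i)) hE big_cons opprD mulrDl !mulrBr.
  over.
rewrite big_cons big_split /= !sumrB.
rewrite -/(p _).
have := IHvs m; rewrite -/(h _) big_ord_recr /= subnn => IHm.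
(* Multiplication by 1 - v X turns the terms coming from the powers of v into a telescoping sum, of
   which only the two ends remain. *)
have tel : \sum_(i < m) - v ^+ i.+1 * h (m - i.+1).+1
   - \sum_(i < m) - v ^+ i.+1 * (v * h (m - i.+1)%N) = - v * h m + v ^+ m.+1 * h 0%N.
  rewrite -sumrB (eq_bigr (fun i : 'I_m => v ^+ i.+2 * h (m - i.+1)%N - v ^+ i.+1 * h (m - i)%N)).
    have := telescope_sumr (fun i => v ^+ i.+1 * h (m - i)%N) (leq0n m).
    rewrite big_mkord => ->; rewrite subnn subn0 expr1; ring.
  move=> i _; rewrite subnSK // [v ^+ i.+2]exprS; ring.
have fold1 : \sum_(i < m) - (\sum_(j <- vs) j ^+ i.+1) * h (m - i.+1).+1 =
    h m.+1 *+ m.+1 + p m.+1 * h 0%N.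
  rewrite IHm /p mulNr addrNK; apply: eq_bigr => i _.
  by rewrite subnSK.
have fold2 : \sum_(i < m) - (\sum_(j <- vs) j ^+ i.+1) * (v * h (m - i.+1)%N) = v * (h m *+ m).
  case: m {IHm hE tel fold1} => [|m]; first by rewrite big_ord0 mulr0n mulr0.
  rewrite [h m.+1 *+ _]IHvs mulr_sumr; apply: eq_bigr => i _.
  by rewrite subSS mulrCA.
rewrite fold1 fold2 tel; clear; clearbody h p; ring.
Qed.

(** By Newton's recursion the coefficients of the product of the 1 - v T are nonnegative. The
    coefficient at n + 1 > [size vs] vanishes, so every term of its recursion does; the last term is
    minus the power sum in question. *)
Lemma nonpos_power_sums (R : numDomainType) (vs : seq R) :
  (forall n, \sum_(v <- vs) v ^+ n.+1 <= 0) ->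
  forall n, (size vs <= n)%N -> \sum_(v <- vs) v ^+ n.+1 = 0.
Proof.
move=> p_le0 n le_n.
pose h k := (\prod_(v <- vs) (1 - v *: 'X))`_k.
have h0 : h 0%N = 1.
  rewrite /h -horner_coef0 horner_prod big1 // => v _.
  by rewrite !hornerE ?mulr0 ?subr0.
have h_ge0 k : 0 <= h k.
  elim/ltn_ind: k => -[|k] IHk; first by rewrite h0.
  rewrite -(pmulrn_lge0 _ (ltn0Sn k)) [h _ *+ _](newton_log_deriv vs).
  by rewrite sumr_ge0 // => i _; rewrite mulr_ge0 ?oppr_ge0 // IHk // ltnS leq_subr.
have h_n : h n.+1 = 0.
  rewrite /h nth_default //; apply: leq_trans (_ : (size vs).+1 <= _)%N => //.
  elim: {p_le0 le_n h h0 h_ge0} vs => [|v vs IHvs] /=; first by rewrite big_nil size_poly1.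
  rewrite big_cons.
  apply: leq_trans (size_polyMleq _ _) _.
  have : (size (1 - v *: 'X)%R <= 2)%N.
    rewrite (leq_trans (size_polyD _ _)) // size_poly1 size_polyN geq_max /=.
    by rewrite (leq_trans (size_scale_leq _ _)) // size_polyX.
  by move: (size _) IHvs => a le_a; move: (size _) => b; lia.
have := newton_log_deriv vs n; rewrite -/(h _) h_n mul0rn => /esym/eqP.
rewrite psumr_eq0; last first.
  by move=> i _; rewrite mulr_ge0 ?oppr_ge0 // h_ge0.
move/allP/(_ ord_max); rewrite mem_index_enum => /(_ isT) /=.
by rewrite subnn -/(h _) h0 mulr1 oppr_eq0 => /eqP.
Qed.

(* If some |w| = rho >= b, rotate w to the positive real axis: twice rho ^ n dominates the
   sum and its conjugate, so the power sums of the remaining numbers are nonpositive. *)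
Lemma norm_lt_of_power_sums (ws : seq algC) (b : algC) :
  (forall n, `|\sum_(w <- ws) w ^+ n.+1| <= b ^+ n.+1) ->
  (forall m, exists2 n, (m <= n)%N & `|\sum_(w <- ws) w ^+ n.+1| < b ^+ n.+1) ->
  forall w, w \in ws -> `|w| < b.
Proof.
move=> le_b lt_b w ws_w.
have b_ge0 : 0 <= b by have := le_b 0%N; rewrite expr1; apply: le_trans.
rewrite real_ltNge ?normr_real ?ger0_real //; apply/negP => le_bw.
have w0 : w != 0.
  apply/eqP => w0; move: le_bw; rewrite w0 normr0 => le_b0.
  have eb : b = 0 by apply/eqP; rewrite eq_le le_b0.
  have [n _] := lt_b 0%N; rewrite eb exprS mul0r => H.
  by have := le_lt_trans (normr_ge0 _) H; rewrite ltxx.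
pose y := w / `|w|.
have nw0 : `|w| != 0 by rewrite normr_eq0.
have y0 : y != 0 by rewrite mulf_neq0 ?invr_eq0.
have ny : `|y| = 1 by rewrite normrM normrV ?unitfE // normr_id divff.
pose T n := (\sum_(w <- ws) w ^+ n.+1) / y ^+ n.+1.
pose vs := [seq v / y | v <- rem w ws] ++ [seq (v / y)^* | v <- rem w ws].
have pvs n : \sum_(v <- vs) v ^+ n.+1 = 2 * ('Re (T n) - `|w| ^+ n.+1).
  have T1 : \sum_(v <- [seq v / y | v <- rem w ws]) v ^+ n.+1 = T n - `|w| ^+ n.+1.
    rewrite /T (perm_big _ (perm_to_rem ws_w)) /= big_cons big_map mulrDl addrAC.
    have -> : w ^+ n.+1 / y ^+ n.+1 = `|w| ^+ n.+1.
      rewrite -expr_div_n; congr (_ ^+ _); rewrite /y invf_div mulrCA divff ?mulr1 //.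
    rewrite subrr add0r mulr_suml; apply: eq_bigr => i _; exact: expr_div_n.
  have T2 : \sum_(v <- [seq (v / y)^* | v <- rem w ws]) v ^+ n.+1 = (T n - `|w| ^+ n.+1)^*.
    by rewrite -T1 !big_map rmorph_sum; apply: eq_bigr => i _; rewrite rmorphXn.
  rewrite /vs big_cat /= T1 T2 rmorphB rmorphXn /= (conj_Creal (normr_real w)).
  rewrite [in RHS]ReE mulrBr mulrC divfK ?pnatr_eq0 //; ring.
have ReT n : 'Re (T n) <= `|\sum_(w <- ws) w ^+ n.+1|.
  have -> : `|\sum_(w <- ws) w ^+ n.+1| = `|T n|.
    by rewrite normrM normrV ?unitfE ?expf_neq0 // normrX ny expr1n invr1 mulr1.
  apply: le_trans (real_ler_norm (Creal_Re _)) _.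
  by rewrite (leif_normC_Re_Creal (T n)).
have p_le0 n : \sum_(v <- vs) v ^+ n.+1 <= 0.
  rewrite pvs pmulr_rle0 ?ltr0n // subr_le0.
  apply: le_trans (ReT n) (le_trans (le_b n) _).
  by rewrite lerXn2r // nnegrE.
(* Past [size vs] the power sums of [vs] vanish, so the real part of [T n] equals |w|^(n+1) >=
   b^(n+1), against the strict bound at this index. *)
have [n le_n lt_n] := lt_b (size vs).
have := nonpos_power_sums p_le0 le_n; rewrite pvs => /eqP.
rewrite mulf_eq0 pnatr_eq0 /= subr_eq0 => /eqP eT.
have := le_lt_trans (ReT n) lt_n; rewrite eT => H.
have : `|w| ^+ n.+1 < `|w| ^+ n.+1 by apply: lt_le_trans H _; rewrite lerXn2r // nnegrE.
by rewrite ltxx.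
Qed.

(** * Prime powers dividing monic polynomials *)

Section MonicPolynomials.
Variable F : finFieldType.
Implicit Types f P : {poly F}.

Definition monics m : seq {poly F} :=
  [seq 'X^m + (val p : {poly F}) | p <- enum {: {poly_m F}}].

Lemma mem_monics m f : (f \in monics m) = (f \is monic) && (size f == m.+1).
Proof.
apply/mapP/andP => [[p _ ->]|[f_mon /eqP sf]].
  have lt_p : (size (val p) < size ('X^m : {poly F}))%N.
    by rewrite size_polyXn ltnS size_npoly.
  by rewrite monicE lead_coefDl // size_polyDl // lead_coefXn size_polyXn !eqxx.
have le_m : (size (f - 'X^m)%R <= m)%N.
  apply/leq_sizeP => j; rewrite leq_eqVlt coefB coefXn => /orP[/eqP<-|lt_mj].
    by move: f_mon; rewrite monicE /lead_coef sf /= eqxx => /eqP->; rewrite subrr.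
  by rewrite nth_default ?sf // gtn_eqF // subr0.
by exists (NPoly le_m); rewrite ?mem_enum //= addrC subrK.
Qed.

Lemma monics_monic m f : f \in monics m -> f \is monic.
Proof. by rewrite mem_monics => /andP[]. Qed.

Lemma size_monic m f : f \in monics m -> size f = m.+1.
Proof. by rewrite mem_monics => /andP[_ /eqP]. Qed.

Lemma uniq_monics m : uniq (monics m).
Proof. by rewrite map_inj_uniq ?enum_uniq // => p p' /addrI /val_inj. Qed.

Lemma size_monics m : size (monics m) = (#|F| ^ m)%N.
Proof. by rewrite size_map -cardE card_npoly. Qed.

Definition monic_irreds e : seq {poly F} := [seq f <- monics e | irreducibleb f].

Lemma mem_monic_irreds e P :
  reflect [/\ P \is monic, size P = e.+1 & irreducible_poly P] (P \in monic_irreds e).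
Proof.
rewrite mem_filter mem_monics; apply: (iffP and3P).
  by case=> /irreducibleP ? ? /eqP.
by case=> ? -> /irreducibleP.
Qed.

Lemma monic_irred_factor f : f \is monic -> (1 < size f)%N ->
  exists2 P, P \is monic /\ irreducible_poly P & P %| f.
Proof.
have [n] := ubnP (size f); elim: n f => // n IHn f; rewrite ltnS => le_f f_mon f_gt1.
have [/irreducibleP f_irr|] := boolP (irreducibleb f); first by exists f.
rewrite /irreducibleb f_gt1 /= => /'forall_implyP /= not_irr.
have [/forallP irr|] := boolP [forall q : {poly_((size f).-1) F},
    (Pdiv.Ring.rdvdp (val q) f) ==> (size (val q) <= 1)%N].
  by case: not_irr => q; apply/implyP/irr.
rewrite negb_forall => /existsP [q]; rewrite negb_imply -Pdiv.Idomain.dvdpE.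
case/andP=> dvd_q; rewrite -ltnNge => q_gt1.
have q0 : val q != 0 by rewrite -size_poly_gt0 (ltn_trans _ q_gt1).
pose h := (lead_coef (val q))^-1 *: val q.
have lc0 : (lead_coef (val q))^-1 != 0 by rewrite invr_eq0 lead_coef_eq0.
have h_mon : h \is monic by rewrite monicE lead_coefZ mulVf // lead_coef_eq0.
have sh : size h = size (val q) by rewrite size_scale.
have [] := IHn h _ h_mon _; rewrite ?sh //.
  by apply: leq_ltn_trans (size_npoly q) _; lia.
move=> P P_irr dvdP; exists P => //.
by rewrite (dvdp_trans dvdP) // dvdpZl.
Qed.

Lemma monic_irred_dvd P Q : P \is monic -> Q \is monic ->
  irreducible_poly P -> irreducible_poly Q -> (P %| Q) = (P == Q).
Proof.
move=> P_mon Q_mon [P_gt1 _] [_ Q_irr].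
apply/idP/eqP => [/Q_irr PQ|->]; last exact: dvdpp.
by apply/eqP; rewrite -eqp_monic //; apply: PQ; rewrite neq_ltn P_gt1 orbT.
Qed.

Lemma monic_irred_coprime P Q : P \is monic -> Q \is monic ->
  irreducible_poly P -> irreducible_poly Q -> P != Q -> coprimep P Q.
Proof.
move=> P_mon Q_mon P_irr Q_irr neq.
by rewrite irreducible_poly_coprime // monic_irred_dvd.
Qed.

Lemma size_monic_exp P e k : P \is monic -> size P = e.+1 -> size (P ^+ k) = (e * k).+1.
Proof.
move=> P_mon sP; rewrite -[size _]prednK ?size_exp ?sP //.
by rewrite size_poly_gt0 monic_neq0 // monic_exp.
Qed.

(** The analogue of log n being the sum of Lambda(d) over d | n. Removing one irreducible factor Q
    from f changes only the contribution of the powers of Q, by a single term deg Q. The bound [N]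
    on degrees and exponents fixes the ranges throughout the induction. *)
Lemma deg_sum_prime_powers N m f : (m <= N)%N -> f \in monics m ->
  (\sum_(e < N.+1) \sum_(P <- monic_irreds e) \sum_(k < N) (P ^+ k.+1 %| f)%R * e = m)%N.
Proof.
move=> le_mN; elim/ltn_ind: m f le_mN => m IHm f le_mN f_m.
have [f_mon sf] := (monics_monic f_m, size_monic f_m).
have [m0|m_gt0] := posnP m.
  rewrite m0 in sf *; rewrite big1 // => e _;
    rewrite big_seq big1 // => P /mem_monic_irreds [P_mon sP [P_gt1 _]].
  rewrite big1 // => k _; rewrite (_ : _ %| _ = false) //; apply/negP => /dvdp_leq.
  rewrite sf (size_monic_exp _ P_mon sP) -size_poly_gt0 sf => /(_ isT).
  by move: P_gt1; rewrite sP; lia.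
have f_gt1 : (1 < size f)%N by rewrite sf.
have [Q [Q_mon Q_irr] /dvdpP [f1 ff1]] := monic_irred_factor f_mon f_gt1.
have Q_gt1 := Q_irr.1.
pose d := (size Q).-1; have sQ : size Q = d.+1 by rewrite prednK // ltnW.
have f1_mon : f1 \is monic by rewrite -(monicMl _ Q_mon) mulrC -ff1.
have md : m = ((size f1).-1 + d)%N.
  have := sf; rewrite ff1 size_Mmonic ?monic_neq0 // sQ addnS /=.
  have := monic_neq0 f1_mon; rewrite -size_poly_gt0; by case: (size f1) => //= a _ [<-].
have f1_m : f1 \in monics (m - d).
  rewrite mem_monics f1_mon md addnK prednK ?eqxx //.
  by rewrite size_poly_gt0 monic_neq0.
have d_gt0 : (0 < d)%N by move: Q_gt1; rewrite sQ.
have le_dN : (d < N.+1)%N by move: md le_mN; lia.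
have lt_md : (m - d < m)%N by lia.
have le_mdN : (m - d <= N)%N by lia.
have IH1 := IHm _ lt_md f1 le_mdN f1_m.
have Qd : Q \in monic_irreds (Ordinal le_dN) by apply/mem_monic_irreds.
rewrite [RHS](_ : m = (m - d) + d)%N; last lia.
rewrite -[in RHS]IH1 (bigD1 (Ordinal le_dN)) //= [in RHS](bigD1 (Ordinal le_dN)) //=.
have uQ e : uniq (monic_irreds e) by rewrite filter_uniq ?uniq_monics.
have step P : P \is monic -> irreducible_poly P -> P != Q ->
    forall k, (P ^+ k %| f) = (P ^+ k %| f1).
  move=> P_mon P_irr neq k; rewrite ff1 Gauss_dvdpl //.
  by rewrite coprimep_expl // monic_irred_coprime.
rewrite addnAC; congr (_ + _)%N; last first.
  apply: eq_bigr => e ne; apply: eq_big_seq => P /mem_monic_irreds [P_mon sP P_irr].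
  apply: eq_bigr => k _; rewrite step //; apply: contraNneq ne => PQ.
  by apply/eqP/val_inj; move: sP; rewrite PQ sQ => -[].
rewrite (bigD1_seq Q) //= [in RHS](bigD1_seq Q) //= addnAC; congr (_ + _)%N; last first.
  rewrite big_seq_cond [RHS]big_seq_cond;
    apply: eq_bigr => P /andP[/mem_monic_irreds [P_mon sP P_irr] neq].
  by apply: eq_bigr => k _; rewrite step.
(* Q^(k+1) divides f exactly when Q^k divides f1, so the exponents are shifted by one; the top
   exponent cannot occur for f1 by degree. *)
case: N le_mN {IHm IH1 le_mdN} le_dN Qd => [|N] le_mN le_dN Qd; first by lia.
rewrite big_ord_recl [in RHS]big_ord_recr /=.
have -> : (Q ^+ 1 %| f)%R by rewrite ff1 expr1 dvdp_mull.
have -> : (Q ^+ N.+1 %| f1)%R = false.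
  apply/negP => /dvdp_leq; rewrite monic_neq0 // (size_monic_exp _ Q_mon sQ) (size_monic f1_m).
  by move/(_ isT); nia.
rewrite mul1n mul0n addn0 addnC; congr (_ + _)%N; apply: eq_bigr => k _.
by rewrite ff1 /bump /= add1n exprSr dvdp_mul2r // monic_neq0.
Qed.

Variable R : comNzRingType.
Variable xi : {poly F} -> R.
Hypothesis xi1 : xi 1 = 1.
Hypothesis xiM : forall f h, xi (f * h) = xi f * xi h.

(** The coefficient of T^m in the L-series of [xi]. *)
Definition monic_sum m := \sum_(f <- monics m) xi f.

(** The coefficient of T^n in the logarithmic derivative of the Euler product of that L-series: a
    prime power P^k of degree n has weight deg P. *)
Definition prime_power_sum n :=
  \sum_(e < n.+1) \sum_(k < n.+1 | (e * k == n)%N) (\sum_(P <- monic_irreds e) xi P ^+ k) *+ e.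

Lemma monic_sum0 : monic_sum 0 = 1.
Proof.
rewrite /monic_sum (_ : monics 0 = [:: 1]) ?big_seq1 //.
apply: perm_small_eq => //; apply: uniq_perm; rewrite ?uniq_monics // => f.
rewrite mem_monics inE; apply/andP/eqP => [[f_mon /size_poly1P [c _ fc]]|->].
  by move: f_mon; rewrite fc monicE lead_coefC => /eqP->.
by rewrite monic1 size_poly1.
Qed.

Lemma sum_multiples m e (P : {poly F}) k : P \in monic_irreds e ->
  \sum_(f <- monics m | P ^+ k %| f) xi f =
  if (e * k <= m)%N then xi P ^+ k * monic_sum (m - e * k) else 0.
Proof.
case/mem_monic_irreds => P_mon sP P_irr; have P0 := monic_neq0 P_mon.
have sPk := size_monic_exp k P_mon sP.
case: ifP => [le_m|gt_m]; last first.
  rewrite big_seq_cond big1 // => f /andP[f_m /dvdp_leq].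
  by rewrite (monic_neq0 (monics_monic f_m)) sPk (size_monic f_m) ltnS gt_m => /(_ isT).
have xiX j : xi P ^+ j = xi (P ^+ j).
  by elim: j => [|j IHj]; rewrite ?xi1 // exprS IHj -xiM -exprS.
rewrite xiX mulr_sumr -big_filter.
rewrite (perm_big [seq P ^+ k * f | f <- monics (m - e * k)]) /=.
  by rewrite big_map; apply: eq_bigr => f _; rewrite xiM.
apply: uniq_perm; first by rewrite filter_uniq ?uniq_monics.
  by rewrite map_inj_uniq ?uniq_monics // => f h /mulfI; apply; rewrite expf_neq0.
move=> f; rewrite mem_filter mem_monics.
apply/and3P/mapP => [[/dvdpP [h ->] hmon /eqP sh]|[h h_m ->]].
  have h_mon : h \is monic by rewrite -(monicMr _ (monic_exp k P_mon)).
  exists h; last by rewrite mulrC.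
  rewrite mem_monics h_mon; move: sh; rewrite size_Mmonic ?monic_neq0 ?monic_exp // sPk.
  by rewrite addnS /=; lia.
have h_mon := monics_monic h_m; rewrite dvdp_mulr ?dvdpp //.
rewrite rpredM ?monic_exp // mulrC size_Mmonic ?monic_neq0 ?monic_exp // sPk (size_monic h_m).
by split=> //; apply/eqP; lia.
Qed.

(* Both sides equal the sum of [deg f * xi f], by writing [deg f] as the sum of [deg P] over
   the prime powers dividing [f]. *)
Lemma monic_sum_log_deriv : log_deriv monic_sum prime_power_sum.
Proof.
move=> m.
have -> : monic_sum m.+1 *+ m.+1 = \sum_(e < m.+2) \sum_(k < m.+1)
    (\sum_(P <- monic_irreds e) \sum_(f <- monics m.+1 | P ^+ k.+1 %| f) xi f) *+ e.
  rewrite /monic_sum -sumrMnl.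
  rewrite (eq_big_seq (fun f => \sum_(e < m.+2) \sum_(k < m.+1) \sum_(P <- monic_irreds e)
             (xi f *+ (P ^+ k.+1 %| f)%R) *+ e)); last first.
    move=> f f_m; rewrite -{1}(deg_sum_prime_powers (leqnn _) f_m) -sumrMnr.
    apply: eq_bigr => e _; rewrite exchange_big -sumrMnr; apply: eq_bigr => k _.
    by rewrite -sumrMnr; apply: eq_bigr => P _; rewrite mulrnA.
  rewrite exchange_big; apply: eq_bigr => e _; rewrite exchange_big; apply: eq_bigr => k _.
  rewrite exchange_big -sumrMnl; apply: eq_bigr => P _.
  by rewrite -sumrMnl [RHS]big_mkcond; apply: eq_bigr => f _; case: ifP => _;
    rewrite ?mulr0n ?mul0rn.
pose S (e k : nat) := (\sum_(P <- monic_irreds e) xi P ^+ k) *+ e.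
(* The ranges of [e] and [k] are widened to a bound independent of [i], so that the sums can be
   exchanged; the added pairs never satisfy e k = i + 1. *)
have -> : \sum_(i < m.+1) prime_power_sum i.+1 * monic_sum (m - i) =
    \sum_(i < m.+1) \sum_(e < m.+2) \sum_(k < m.+2 | (e * k == i.+1)%N) S e k * monic_sum (m - i).
  apply: eq_bigr => i _; rewrite mulr_suml.
  have le_i : (i.+2 <= m.+2)%N by rewrite !ltnS -ltnS ltn_ord.
  rewrite (big_ord_widen _ (fun e : nat => (\sum_(k < i.+2 | (e * k == i.+1)%N) S e k) * monic_sum
    (m - i)) le_i) /=.
  rewrite [RHS](bigID (fun e : 'I_m.+2 => (e < i.+2)%N)) /= [X in _ = _ + X]big1 ?addr0.
    apply: eq_bigr => e _; rewrite mulr_suml.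
    rewrite (big_ord_widen_cond _ (fun k : nat => (e * k == i.+1)%N) (fun k : nat => S e k *
      monic_sum (m - i)) le_i).
    apply: eq_bigl => k; case: eqP => //= ek; move: ek.
    by case: (nat_of_ord e) => // e0 ek; rewrite ltnS -ek leq_pmull.
  move=> e; rewrite -leqNgt => gt_e; rewrite big1 // => k /eqP ek; move: gt_e; rewrite -ek.
  move: ek; case: (nat_of_ord k) => [|k0]; first by rewrite muln0.
  by move=> _; rewrite ltnNge leq_pmulr.
rewrite [RHS]exchange_big; apply: eq_bigr => e _ /=.
rewrite (exchange_big_dep predT) //= [in RHS]big_ord_recl /=.
rewrite [in RHS]big_pred0 ?add0r; last by move=> i; rewrite muln0.
apply: eq_bigr => k _; rewrite /bump leq0n add1n.
have [e0|e_gt0] := posnP e.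
  by rewrite e0 mulr0n big1 // => i; rewrite mul0n.
rewrite (eq_big_seq (fun P : {poly F} => if (e * k.+1 <= m.+1)%N then xi P ^+ k.+1 * monic_sum
  (m.+1 - e * k.+1) else 0)); last first.
  by move=> P; apply: sum_multiples.
have [le_m|gt_m] := leqP (e * k.+1) m.+1; last first.
  rewrite big1 // mul0rn big1 // => i /eqP ei; have := ltn_ord i; nia.
have ek_gt0 : (0 < e * k.+1)%N by rewrite muln_gt0 e_gt0.
have lt_i : ((e * k.+1).-1 < m.+1)%N by rewrite prednK.
rewrite (big_pred1 (Ordinal lt_i)) /=; last first.
  by move=> i; apply/eqP/eqP => [ek|->]; [apply: val_inj; rewrite /= ek | rewrite /= prednK].
by rewrite /S mulrnAl -mulr_suml -(prednK ek_gt0) subSS.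
Qed.

End MonicPolynomials.

(** * Primes in residue classes *)

(** The constant term 1 excludes the root 0, so each X - z can be written as - z (1 - z^-1 X); it
    also forces the remaining scalar to be 1. *)
Lemma poly_split_from_1 (L : closedFieldType) (p : {poly L}) :
  p`_0 = 1 -> exists ws : seq L, p = \prod_(w <- ws) (1 - w *: 'X).
Proof.
move=> p0; have [r rE] := closed_field_poly_normal p.
have r0 z : z \in r -> z != 0.
  move=> rz; apply/eqP => z0; rewrite z0 in rz.
  have : root p 0.
    rewrite rE rootZ ?root_prod_XsubC // lead_coef_eq0.
    by apply/eqP => p00; move: p0; rewrite p00 coef0 => /eqP; rewrite eq_sym oner_eq0.
  by rewrite rootE horner_coef0 p0 oner_eq0.
have [c pE] : exists c, p = c *: \prod_(w <- [seq z^-1 | z <- r]) (1 - w *: 'X).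
  rewrite rE; move: (lead_coef p) => c; elim: r r0 {rE} => [|z r IHr] r0.
    by exists c; rewrite !big_nil.
  have [|c' E] := IHr; first by move=> y ry; apply: r0; rewrite inE ry orbT.
  exists (- z * c'); rewrite /= !big_cons scalerAr E.
  have -> : 'X - z%:P = (- z) *: (1 - z^-1 *: 'X).
    rewrite scalerBr scalerA mulNr divff ?r0 ?mem_head // scaleN1r opprK scaleNr addrC.
    by rewrite -alg_polyC.
  by rewrite -scalerAl -scalerAr scalerA.
exists [seq z^-1 | z <- r]; rewrite {1}pE.
suff -> : c = 1 by rewrite scale1r.
move: p0; rewrite pE coefZ -horner_coef0 horner_prod big1 ?mulr1 // => w _.
by rewrite !hornerE ?mulr0 ?subr0.
Qed.

(** Bernoulli's inequality for x^-1 = 1 + D gives x^-N >= 1 + N D, which exceeds eps^-1 once N >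
    eps^-1 / D. *)
Lemma exp_lt_eps (R : archiNumFieldType) (x eps : R) : 0 <= x < 1 -> 0 < eps ->
  exists N, forall n, (N <= n)%N -> x ^+ n <= eps.
Proof.
case/andP=> x_ge0 x_lt1 eps_gt0.
have [->|x0] := eqVneq x 0.
  by exists 1%N => -[|n] // _; rewrite exprS mul0r ltW.
have x_gt0 : 0 < x by rewrite lt_def x0.
pose D := x^-1 - 1.
have D_gt0 : 0 < D by rewrite subr_gt0 invf_gt1.
have bern n : 1 + n%:R * D <= (1 + D) ^+ n.
  elim: n => [|n IHn]; first by rewrite mul0r addr0 expr0.
  rewrite exprS; apply: le_trans (ler_wpM2l _ IHn); last by rewrite addr_ge0 // ltW.
  rewrite -subr_ge0 -natr1 (_ : _ - _ = n%:R * D * D); last by ring.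
  by rewrite !mulr_ge0 ?ler0n // ltW.
pose N := Num.bound (eps^-1 / D).
have xE : (1 + D) = x^-1 by rewrite addrC subrK.
exists N => n le_N; apply: le_trans (_ : x ^+ N <= _).
  by rewrite ler_wiXn2l // ltW.
rewrite -[_ ^+ N]invrK -[eps]invrK lef_pV2 ?posrE ?invr_gt0 ?exprn_gt0 //.
rewrite -exprVn -xE; apply: le_trans (bern N).
have : eps^-1 / D < N%:R by apply: archi_boundP; apply: divr_ge0; rewrite ?invr_ge0 ltW.
by rewrite ltr_pdivrMr // => /ltW le_ND; apply: le_trans le_ND _; rewrite lerDr ler01.
Qed.

(** The L-series of the constant 1 is the geometric series 1 / (1 - q T), whose logarithmic
    derivative has coefficients q^n. This is Gauss's count of irreducible polynomials. *)
Lemma prime_power_sum1 (F : finFieldType) n :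
  prime_power_sum (fun _ : {poly F} => 1 : algC) n.+1 = (#|F| ^ n.+1)%:R.
Proof.
pose a m := monic_sum (fun _ : {poly F} => 1 : algC) m.
have aE m : a m = (#|F| ^ m)%:R.
  by rewrite /a /monic_sum big_const_seq count_predT size_monics iter_addr addr0.
apply: (@log_deriv_uniq _ a _ (fun n => (#|F| ^ n)%:R) _ _ _ n); first by rewrite aE.
  by apply: monic_sum_log_deriv => // f h; rewrite mulr1.
move=> m; rewrite aE (eq_bigr (fun _ => (#|F| ^ m.+1)%:R)).
  by rewrite sumr_const card_ord.
by move=> i _; rewrite aE -natrM -expnD addSn subnKC // -ltnS.
Qed.

(** * Dirichlet characters modulo an irreducible polynomial and their L-polynomials *)

Section Characters.
Variables (F : finFieldType) (g : {poly F}) (gI : monic_irreducible_poly g).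
Local Notation k := {poly %/ g with gI}.
Local Notation G := [set: {unit k}]%G.
Local Notation q := #|F|.
Local Notation d := (size g).-1.

(** [in_qpoly g] retyped with the field [k] as codomain, to be declared a ring morphism into that
    field. *)
Definition resid (f : {poly F}) : k := in_qpoly g f.

Fact resid_is_zmod_morphism : zmod_morphism resid.
Proof. exact: (raddfB (in_qpoly g)). Qed.

Fact resid_is_monoid_morphism : monoid_morphism resid.
Proof. by split; [exact: (rmorph1 (in_qpoly g)) | exact: (rmorphM (in_qpoly g))]. Qed.

HB.instance Definition _ := GRing.isZmodMorphism.Build {poly F} k resid resid_is_zmod_morphism.
HB.instance Definition _ := GRing.isMonoidMorphism.Build {poly F} k resid resid_is_monoid_morphism.

Lemma residM f h : resid (f * h) = resid f * resid h.
Proof. exact: rmorphM. Qed.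

Lemma resid1 : resid 1 = 1.
Proof. exact: rmorph1. Qed.

Lemma residD f h : resid (f + h) = resid f + resid h.
Proof. exact: rmorphD. Qed.

Lemma resid_eq0 f : (resid f == 0) = (g %| f).
Proof.
by rewrite -val_eqE /= Pdiv.Idomain.dvdpE /Pdiv.Ring.rdvdp mk_monicE.
Qed.

(** The Dirichlet character attached to a character of the unit group of [k]; [insub] fails on
    non-units, which gives the value 0 there. *)
Definition chi (i : Iirr G) (f : {poly F}) : algC := oapp 'chi[G]_i 0 (insub (resid f)).

Lemma chi_dvd i f : g %| f -> chi i f = 0.
Proof.
rewrite -resid_eq0 => /eqP f0; rewrite /chi insubF //.
by rewrite f0 unitr0.
Qed.

Lemma lin_chi i : 'chi[G]_i \is a linear_char.
Proof. by apply/char_abelianP; apply/centsP => x _ y _; apply/val_inj/mulrC. Qed.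

Lemma chiE i f (u : {unit k}) : resid f = val u -> chi i f = 'chi[G]_i u.
Proof. by move=> fu; rewrite /chi fu valK. Qed.

Lemma chi1 i : chi i 1 = 1.
Proof. by rewrite (@chiE i 1 1%g) ?resid1 // lin_char1 ?lin_chi. Qed.

Lemma chiM i f h : chi i (f * h) = chi i f * chi i h.
Proof.
have [uf|nuf] := boolP (resid f \is a GRing.unit); last first.
  move: nuf; rewrite unitfE negbK resid_eq0 => gf.
  by rewrite (chi_dvd i gf) mul0r chi_dvd // dvdp_mulr.
have [uh|nuh] := boolP (resid h \is a GRing.unit); last first.
  move: nuh; rewrite unitfE negbK resid_eq0 => gh.
  by rewrite (chi_dvd i gh) mulr0 chi_dvd // dvdp_mull.
pose u := FinRing.unit k uf; pose v := FinRing.unit k uh.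
by rewrite (@chiE i _ (u * v)%g) ?residM // (@chiE i f u) // (@chiE i h v) // lin_charM ?lin_chi
  ?inE.
Qed.

Lemma norm_chi_le1 i f : `|chi i f| <= 1.
Proof.
rewrite /chi; case: insub => [u|] /=; last by rewrite normr0 ler01.
by rewrite normC_lin_char ?lin_chi ?inE.
Qed.

Lemma chi0_coprime f : ~~ (g %| f) -> chi 0 f = 1.
Proof.
rewrite -resid_eq0 -unitfE => uf.
by rewrite (@chiE 0 f (FinRing.unit k uf)) // irr0 cfun1E inE.
Qed.

(** In the abelian group of units every centralizer is the whole group, and conjugate elements are
    equal. *)
Lemma chi_orthogonal (f : {poly F}) a : ~~ (g %| f) -> ~~ (g %| a) ->
  \sum_i chi i f * (chi i a)^* = (#|k|.-1)%:R *+ (resid f == resid a).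
Proof.
rewrite -!resid_eq0 -!unitfE => uf ua.
pose u := FinRing.unit k uf; pose v := FinRing.unit k ua.
under eq_bigr => i _ do rewrite (@chiE i f u) // (@chiE i a v) //.
rewrite second_orthogonality_relation ?inE //.
have abG : abelian G by apply/centsP => x _ y _; apply/val_inj/mulrC.
have -> : 'C_G[u]%g = G by apply/setIidPl; rewrite sub_cent1 (subsetP abG) ?inE.
rewrite card_finField_unit; move/abelian_classP: abG => ->; rewrite ?inE //.
Qed.

Lemma chi_resid i f h : resid f = resid h -> chi i f = chi i h.
Proof. by rewrite /chi => ->. Qed.

Lemma resid_val (r : k) : resid (val r) = r.
Proof. by apply: val_inj => /=; rewrite Pdiv.Ring.rmodp_small // size_mk_monic. Qed.

Lemma val_resid f : val (resid f) = f %% g.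
Proof. by rewrite /= mk_monicE // Pdiv.IdomainMonic.modpE // gI.2. Qed.

(** A nonprincipal character is orthogonal to the principal one, which has index 0. *)
Lemma chi_sum_resid i : i != 0 -> \sum_(r : k) chi i (val r) = 0.
Proof.
move=> i0; rewrite (bigID (fun r : k => r \is a GRing.unit)) /= addrC big1 ?add0r; last first.
  by move=> r nr; rewrite /chi resid_val insubF //; apply/negbTE.
rewrite (reindex_omap (val : {unit k} -> k) insub); last first.
  by move=> r ur; rewrite insubT.
rewrite (eq_bigl (mem G)); last by move=> u; rewrite /= valK eqxx (valP u) inE.
have := cfdot_irr i (0 : Iirr G); rewrite (negbTE i0) cfdotE => /eqP.
rewrite mulf_eq0 invr_eq0 pnatr_eq0 eqn0Ngt cardG_gt0 /= => /eqP sum0.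
rewrite -[RHS]sum0; apply: eq_bigr => u _.
by rewrite (@chiE i _ u) ?resid_val // irr0 cfun1E inE rmorph1 mulr1.
Qed.

Lemma size_modulus : size g = d.+1.
Proof. by rewrite prednK // ltnW // gI.1.1. Qed.

Lemma size_resid (r : k) : (size (val r : {poly F}) < size g)%N.
Proof. by have -> : size g = size (mk_monic g); [rewrite mk_monicE | apply: size_mk_monic]. Qed.

(** A monic polynomial of degree j >= d is p g + r with p monic of degree j - d and r an arbitrary
    residue, so the sum splits into sums over full residue systems. Hence the L-series is a
    polynomial of degree less than d. *)
Lemma chi_monic_sum i j : i != 0 -> (d <= j)%N -> monic_sum (chi i) j = 0.
Proof.
move=> i0 le_dj; have g_mon := gI.2.
pose mk (p : {poly F}) (r : k) : {poly F} := p * g + val r.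
have lt_pg (p : {poly F}) (r : k) : p \is monic -> (size (val r : {poly F}) < size (p * g)%R)%N.
  move=> p_mon; apply: leq_trans (size_resid r) _.
  by rewrite mulrC size_Mmonic ?monic_neq0 // size_modulus addSn /= -addn1 leq_add2l size_poly_gt0
    monic_neq0.
rewrite /monic_sum (perm_big [seq mk p r | p <- monics F (j - d), r <- enum k]) /=.
  rewrite big_allpairs_dep big1 // => p _.
  rewrite big_enum /= -[RHS](chi_sum_resid i0); apply: eq_bigr => r _.
  apply: chi_resid; rewrite residD residM.
  by have /eqP -> : resid g == 0; rewrite ?resid_eq0 ?dvdpp // mulr0 add0r.
apply: uniq_perm; first exact: uniq_monics.
  apply: allpairs_uniq; rewrite ?uniq_monics ?enum_uniq //.
  case=> p r [p' r'] _ _ /= E.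
  have divE (p1 : {poly F}) (r1 : k) : (mk p1 r1) %/ g = p1.
    by rewrite /mk divp_addl_mul_small // size_resid.
  have Ep : p = p' by rewrite -(divE p r) E divE.
  by move: E; rewrite Ep /mk => /addrI /val_inj ->.
move=> f; rewrite mem_monics; apply/andP/allpairsP => [[f_mon /eqP sf]|[[p r] [/= p_j _ ->]]].
  exists (f %/ g, resid f) => /=; split; rewrite ?mem_enum //.
    have sfg : size (f %/ g) = (j - d).+1.
      by rewrite size_divp ?monic_neq0 // sf subSn.
    rewrite mem_monics sfg eqxx andbT monicE -(lead_coef_Mmonic _ g_mon).
    move: f_mon; rewrite monicE {1}(divp_eq f g) lead_coefDl //.
    rewrite size_Mmonic -?size_poly_eq0 ?sfg // size_modulus addnS /=.
    have := ltn_modp f g; rewrite monic_neq0 // size_modulus => lt_mod.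
    by apply: leq_trans lt_mod _; lia.
  by rewrite /mk /= {1}(divp_eq f g) -val_resid.
have p_mon := monics_monic p_j.
have pg_mon : p * g \is monic by rewrite rpredM.
rewrite monicE lead_coefDl ?lt_pg // -monicE pg_mon size_polyDl ?lt_pg //.
by rewrite size_Mmonic ?monic_neq0 // (size_monic p_j) size_modulus addnS /=; split=> //;
  apply/eqP; rewrite addSn subnK.
Qed.

(** Here [ws] are the inverse roots of the L-polynomial; Newton's identities compute its logarithmic
    derivative from them. *)
Lemma chi_power_sums i : i != 0 -> exists ws : seq algC,
  forall n, prime_power_sum (chi i) n.+1 = - \sum_(w <- ws) w ^+ n.+1.
Proof.
move=> i0; pose p := \poly_(j < d) monic_sum (chi i) j.
have pE m : p`_m = monic_sum (chi i) m.
  by rewrite coef_poly; case: ltnP => // le_dm; rewrite chi_monic_sum.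
have a0 : monic_sum (chi i) 0 = 1 by apply: monic_sum0; apply: chi1.
have [|ws pws] := @poly_split_from_1 _ p; first by rewrite pE.
have ld : log_deriv (monic_sum (chi i)) (fun n => - \sum_(w <- ws) w ^+ n).
  by move=> m; have := newton_log_deriv ws m; rewrite /= -pws pE => ->; apply: eq_bigr => j _;
    rewrite pE.
by exists ws => n; rewrite (log_deriv_uniq a0 (monic_sum_log_deriv (chi1 i) (chiM i)) ld).
Qed.

Lemma norm_prime_power_sum_le i n :
  `|prime_power_sum (chi i) n| <= prime_power_sum (fun _ : {poly F} => 1) n.
Proof.
apply: le_trans (ler_norm_sum _ _ _) _; apply: ler_sum => e _.
apply: le_trans (ler_norm_sum _ _ _) _; apply: ler_sum => j _.
rewrite normrMn lerMn2r; apply/orP; right.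
apply: le_trans (ler_norm_sum _ _ _) _; apply: ler_sum => P _.
by rewrite expr1n normrX exprn_ile1 // norm_chi_le1.
Qed.

(** The strictness comes from the prime power g^(n+1), whose term is 0 for the character and d for
    the constant 1. *)
Lemma norm_prime_power_sum_lt i n :
  `|prime_power_sum (chi i) (d * n.+1)| < prime_power_sum (fun _ : {poly F} => 1) (d * n.+1).
Proof.
have d_gt0 : (0 < d)%N by have := gI.1.1; rewrite size_modulus.
have g_d : g \in monic_irreds F d by apply/mem_monic_irreds; split;
  [apply: gI.2|apply: size_modulus|apply: gI.1].
have lt_d : (d < (d * n.+1).+1)%N by rewrite ltnS leq_pmulr.
have lt_n : (n.+1 < (d * n.+1).+1)%N by rewrite ltnS leq_pmull.
have cut (e j : nat) : `|(\sum_(P <- monic_irreds F e) chi i P ^+ j) *+ e|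
    <= (\sum_(P <- monic_irreds F e) 1 ^+ j) *+ e :> algC.
  rewrite normrMn lerMn2r; apply/orP; right.
  apply: le_trans (ler_norm_sum _ _ _) _; apply: ler_sum => P _.
  by rewrite expr1n normrX exprn_ile1 // norm_chi_le1.
rewrite /prime_power_sum (bigD1 (Ordinal lt_d)) //= [ltRHS](bigD1 (Ordinal lt_d)) //=.
rewrite (bigD1 (Ordinal lt_n)) //= [in ltRHS](bigD1 (Ordinal lt_n)) //=.
apply: le_lt_trans (ler_normD _ _) _; apply: ltr_leD; last first.
  apply: le_trans (ler_norm_sum _ _ _) _; apply: ler_sum => e _.
  by apply: le_trans (ler_norm_sum _ _ _) _; apply: ler_sum => j _.
apply: le_lt_trans (ler_normD _ _) _; apply: ltr_leD; last first.
  by apply: le_trans (ler_norm_sum _ _ _) _; apply: ler_sum => j _.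
have uQ : uniq (monic_irreds F d) by rewrite filter_uniq ?uniq_monics.
rewrite normrMn ltrMn2r d_gt0 /= !(bigD1_seq g) //= chi_dvd ?dvdpp // exprS mul0r add0r.
apply: le_lt_trans (ler_norm_sum _ _ _) _; rewrite expr1n addrC ltr_pwDr ?ltr01 //.
by apply: ler_sum => P _; rewrite normrX exprn_ile1 // norm_chi_le1.
Qed.

(** All inverse roots satisfy |w| < q, so the finite sum of the (|w| / q)^n tends to 0. *)
Lemma chi_power_sum_small i (eps : algC) : i != 0 -> 0 < eps -> exists N, forall n, (N <= n)%N ->
  `|prime_power_sum (chi i) n.+1| <= eps * (q ^ n.+1)%:R.
Proof.
move=> i0 eps_gt0; have [ws wsE] := chi_power_sums i0.
have q_gt0 : 0 < q%:R :> algC by rewrite ltr0n (ltn_trans _ (finNzRing_gt1 F)).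
have wlt w : w \in ws -> `|w| < q%:R.
  apply: norm_lt_of_power_sums => [n|m].
    rewrite -normrN -wsE -natrX -prime_power_sum1; exact: norm_prime_power_sum_le.
  have d_gt0 : (0 < d)%N by have := gI.1.1; rewrite size_modulus.
  (* The strict bound is known for exponents d (m + 1), and the exponent is one more than the
     index. *)
  exists (d * m.+1).-1; first by nia.
  rewrite -normrN -wsE -natrX -prime_power_sum1 prednK ?muln_gt0 ?d_gt0 //.
  exact: norm_prime_power_sum_lt.
have [N NE] : exists N, forall n, (N <= n)%N ->
    \sum_(w <- ws) (`|w| / q%:R) ^+ n <= eps.
  elim: ws {wsE} wlt eps eps_gt0 => [|w ws IHws] wlt eps eps_gt0.
    by exists 0%N => n _; rewrite big_nil ltW.
  have e2 : 0 < eps / 2 by rewrite divr_gt0 ?ltr0n.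
  have [N1 N1E] := IHws (fun v wv => wlt v (mem_behead (s := w :: ws) wv)) _ e2.
  have [|N2 N2E] := @exp_lt_eps _ (`|w| / q%:R) _ _ e2.
    by rewrite divr_ge0 ?ler0n //= ltr_pdivrMr ?mul1r ?wlt ?mem_head.
  exists (maxn N1 N2) => n; rewrite geq_max => /andP[le1 le2].
  rewrite big_cons [leRHS](splitr eps) lerD ?N1E ?N2E //.
exists N => n le_N; rewrite wsE normrN.
apply: le_trans (ler_norm_sum _ _ _) _.
have := NE n.+1 (leqW le_N); rewrite natrX -ler_pdivrMr ?exprn_gt0 //; apply: le_trans.
by rewrite mulr_suml; apply: ler_sum => w _; rewrite normrX expr_div_n.
Qed.

(** For prime n, a prime power P^k of degree n has deg P = n and k = 1, or deg P = 1 and k = n. *)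
Lemma prime_power_sum_prime (xi : {poly F} -> algC) n : prime n ->
  prime_power_sum xi n = (\sum_(P <- monic_irreds F n) xi P) *+ n
                       + \sum_(P <- monic_irreds F 1) xi P ^+ n.
Proof.
move=> pr_n; have n_gt1 := prime_gt1 pr_n.
have lt_1 : (1 < n.+1)%N by rewrite ltnW.
rewrite /prime_power_sum (bigD1 ord_max) //= (big_pred1 (Ordinal lt_1)) /=; last first.
  move=> j; apply/eqP/eqP => [E|->]; last exact: muln1.
  by apply/val_inj/eqP; rewrite /= -(eqn_pmul2l (ltnW n_gt1)) muln1 E.
congr (_ + _).
rewrite (bigD1 (Ordinal lt_1)) /=; last by rewrite -(inj_eq val_inj) /= neq_ltn n_gt1.
rewrite (big_pred1 ord_max) /=; last first.
  by move=> j; rewrite mul1n; apply/eqP/eqP => [E|->] //; apply: val_inj.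
rewrite mulr1n [X in _ + X]big1 ?addr0 // => e /andP[ne_n ne_1].
rewrite big1 // => j /eqP ejn; case/primeP: pr_n => _ /(_ e).
rewrite -[X in (_ %| X)%N]ejn dvdn_mulr // => /(_ isT).
rewrite -[_ == n]/(e == ord_max) (negbTE ne_n) orbF.
by rewrite -[_ == 1%N]/(e == Ordinal lt_1) (negbTE ne_1).
Qed.

(** With Q the order of [k], orthogonality writes n (Q - 1) times the count as a sum over
    characters. The principal one contributes q^n up to an error of at most q, every other one at
    most eps q^n + q in absolute value. *)
Lemma monic_irreds_in_class (a : {poly F}) : ~~ (g %| a) -> exists N, forall n, (N <= n)%N -> prime
  n ->
  (q ^ n <= 4 * #|k| * (n * count (fun P => resid P == resid a) (monic_irreds F n)))%N.
Proof.
move=> na; pose Q := #|k|; have Q_gt1 : (1 < Q)%N := finNzRing_gt1 k.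
have q_gt1 : (1 < q)%N := finNzRing_gt1 F.
(* With this value, fewer than Q nonprincipal characters contribute at most q^n / 4 + Q q
   together. *)
pose eps : algC := (4 * Q)%:R^-1.
have eps_gt0 : 0 < eps by rewrite invr_gt0 ltr0n muln_gt0 /= ltnW.
have [N0 N0E] : exists N, forall i, i != 0 -> forall n, (N <= n)%N ->
    `|prime_power_sum (chi i) n.+1| <= eps * (q ^ n.+1)%:R.
  have /fin_all_exists [f fE] (i : Iirr G) : exists N, i != 0 -> forall n, (N <= n)%N ->
     `|prime_power_sum (chi i) n.+1| <= eps * (q ^ n.+1)%:R.
    have [->|i0] := eqVneq i 0; first by exists 0%N.
    by have [N NE] := chi_power_sum_small i0 eps_gt0; exists N.
  exists (\max_i f i)%N => i i0 n le_n.
  by apply: (fE i) => //; apply: leq_trans le_n; apply: leq_bigmax.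
(* The bound n > d keeps [g] out of the irreducible polynomials of degree n, and n >= 4 Q q lets q^n
   absorb the error terms without [eps]. *)
exists (maxn N0.+1 (maxn d.+1 (4 * Q * q)%N)) => n;
  rewrite !geq_max => /and3P[le_N0 lt_dn le_Q] pr_n.
pose cnt := count (fun P => resid P == resid a) (monic_irreds F n).
pose t i := (\sum_(P <- monic_irreds F n) chi i P) *+ n.
have card_irr1 : (size (monic_irreds F 1) <= q)%N.
  by rewrite size_filter (leq_trans (count_size _ _)) // size_monics expn1.
have ndvd P : P \in monic_irreds F n -> ~~ (g %| P).
  case/mem_monic_irreds => P_mon sP P_irr; rewrite (monic_irred_dvd gI.2 P_mon gI.1 P_irr).
  by apply: contraTneq lt_dn => gP; rewrite gP sP /= ltnn.
have t0 : t 0 = (q ^ n)%:R - (size (monic_irreds F 1))%:R.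
  have := prime_power_sum_prime (fun _ : {poly F} => 1) pr_n.
  rewrite -{1}(prednK (prime_gt0 pr_n)) prime_power_sum1 prednK ?prime_gt0 // => ->.
  rewrite [X in _ = _ + X - _](eq_bigr (fun _ => 1)); last by move=> ? _; rewrite expr1n.
  rewrite [X in _ = _ + X - _]big_const_seq count_predT iter_addr addr0 addrK.
  congr (_ *+ _); apply: eq_big_seq => P /ndvd; exact: chi0_coprime.
have ti i : i != 0 -> `|t i| <= eps * (q ^ n)%:R + q%:R.
  move=> i0; have := prime_power_sum_prime (chi i) pr_n;
    rewrite -/(t i) => /esym/(canRL (addrK _)) ->.
  apply: le_trans (ler_normB _ _) _; apply: lerD.
    by rewrite -(prednK (prime_gt0 pr_n)); apply: N0E => //; rewrite -ltnS prednK ?prime_gt0.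
  apply: le_trans (ler_norm_sum _ _ _) _.
  apply: le_trans (_ : \sum_(P <- monic_irreds F 1) (1 : algC) <= _).
    by apply: ler_sum => P _; rewrite normrX exprn_ile1 // norm_chi_le1.
  by rewrite big_const_seq count_predT iter_addr addr0 ler_nat.
have orth : \sum_i t i * (chi i a)^* = (n * cnt * Q.-1)%:R.
  under eq_bigr => i _ do rewrite /t mulrnAl mulr_suml.
  rewrite sumrMnl exchange_big /=.
  rewrite (eq_big_seq (fun P => (Q.-1)%:R *+ (resid P == resid a))); last first.
    by move=> P /ndvd nP; rewrite chi_orthogonal.
  under eq_bigr => P _ do rewrite mulrb.
  by rewrite -big_mkcond /= -big_filter big_const_seq count_predT iter_addr addr0 size_filter
    -!mulrnA; congr (_ *+ _); rewrite /cnt; lia.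
have card_chars : #|Iirr G| = Q.-1.
  rewrite card_ord NirrE; have abG : abelian G by apply/centsP => x _ y _; apply/val_inj/mulrC.
  by move: abG; rewrite card_classes_abelian => /eqP->; apply: card_finField_unit.
have le_main : t 0 <= (n * cnt * Q.-1)%:R + Q%:R * (eps * (q ^ n)%:R + q%:R).
  have {1}-> : t 0 = (n * cnt * Q.-1)%:R - \sum_(i | i != 0) t i * (chi i a)^*.
    by rewrite -orth (bigD1 0) //= chi0_coprime // rmorph1 mulr1 addrK.
  rewrite lerD2l; apply: le_trans (_ : `|\sum_(i | i != 0) t i * (chi i a)^*| <= _).
    (* The comparison with the norm needs a real number; this sum is a difference of integers. *)
    rewrite -normrN; apply: real_ler_norm; rewrite rpredN.
    have -> : \sum_(i | i != 0) t i * (chi i a)^* = (n * cnt * Q.-1)%:R - t 0.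
      by rewrite -orth [in RHS](bigD1 0) //= chi0_coprime // rmorph1 mulr1 [t 0 + _]addrC addrK.
    by rewrite t0 !rpredB ?realn.
  apply: le_trans (ler_norm_sum _ _ _) _.
  apply: le_trans (_ : \sum_(i : Iirr G) (eps * (q ^ n)%:R + q%:R) <= _); last first.
    rewrite sumr_const card_chars -[leLHS]mulr_natl ler_wpM2r ?ler_nat ?leq_pred //.
    by rewrite addr_ge0 ?mulr_ge0 ?ler0n // ltW.
  rewrite [leRHS](bigID (fun i => i != 0)) /= -[leLHS]addr0 lerD //; last first.
    by apply: sumr_ge0 => i _; rewrite addr_ge0 ?mulr_ge0 ?ler0n // ltW.
  apply: ler_sum => i i0; rewrite normrM norm_conjC -[leRHS]mulr1.
  by apply: ler_pM; rewrite ?normr_ge0 ?norm_chi_le1 ?ti.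
have : ((4 * q ^ n)%:R : algC) <= (4 * (n * cnt * Q.-1) + q ^ n + 4 * Q * q + 4 * q)%:R.
  have := ler_wpM2l (ler0n algC 4) le_main.
  rewrite t0 mulrBr lerBlDr => H; rewrite natrM; apply: le_trans H _.
  rewrite natrD [X in _ <= X + _]natrD [X in _ <= X + _ + _]natrD !natrM mulrDr -!addrA lerD2l.
  have -> : (4%:R * (Q%:R * (eps * (q ^ n)%:R + q%:R)) : algC) =
      (q ^ n)%:R + 4%:R * (Q%:R * q%:R).
    rewrite !mulrDr; congr (_ + _); rewrite !mulrA -natrM mulfV ?mul1r //.
    by rewrite pnatr_eq0 muln_eq0 -lt0n (ltnW Q_gt1).
  by rewrite -!addrA lerD2l mulrA lerD2l -!natrM ler_nat leq_mul2l card_irr1.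
rewrite ler_nat -/cnt -/Q.
have : (n <= q ^ n)%N by apply: ltnW; apply: ltn_expl.
have : (n * cnt * Q.-1 <= Q * (n * cnt))%N by rewrite mulnC leq_mul2r leq_pred orbT.
have : (4 * q <= 2 * Q * q)%N by nia.
move: (q ^ n)%N (n * cnt)%N => E C; nia.
Qed.
End Characters.

(** * Irreducible polynomials and Frobenius *)

Section Frobenius.
Variables (F : finFieldType) (R : comNzRingType) (f : {rmorphism F -> R}).
Local Notation q := #|F|.

Lemma pnat_card_pchar : [pchar R].-nat q.
Proof.
have [p pr_p pF] := finPcharP F.
have pR : p \in [pchar R] := rmorph_pchar f pF.
apply: (@sub_in_pnat p) => [r _ /eqnP -> //|].
by rewrite (@card_pprimeChar p F pF) pnatX pnat_id.
Qed.

Lemma exprD_card (x y : R) e : (x + y) ^+ (q ^ e) = x ^+ (q ^ e) + y ^+ (q ^ e).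
Proof. by apply: exprDn_pchar; rewrite pnatX pnat_card_pchar. Qed.

Lemma exprN_card (x : R) e : (- x) ^+ (q ^ e) = - x ^+ (q ^ e).
Proof. by apply: exprNn_pchar; rewrite pnatX pnat_card_pchar. Qed.

Lemma expr_sum_card (I : Type) (r : seq I) (P : pred I) (G : I -> R) e :
  (\sum_(i <- r | P i) G i) ^+ (q ^ e) = \sum_(i <- r | P i) G i ^+ (q ^ e).
Proof.
elim/big_rec2: _ => [|i y z _ <-]; last exact: exprD_card.
by rewrite expr0n expn_eq0 eqn0Ngt (ltn_trans _ (finNzRing_gt1 F)).
Qed.

Lemma expf_card_exp (a : F) e : a ^+ (q ^ e) = a.
Proof. by elim: e => [|e IHe]; rewrite ?expn0 ?expr1 // expnSr exprM IHe expf_card. Qed.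

(** The q-power map is additive on R and fixes the coefficients, which come from F. *)
Lemma horner_card (p : {poly F}) (x : R) e :
  (map_poly f p).[x] ^+ (q ^ e) = (map_poly f p).[x ^+ (q ^ e)].
Proof.
rewrite !horner_coef expr_sum_card; apply: eq_bigr => i _.
by rewrite exprMn coef_map -rmorphXn expf_card_exp -!exprM mulnC.
Qed.

End Frobenius.

Section IrreducibleOverFiniteField.
Variable F : finFieldType.
Local Notation q := #|F|.

(** If X^(q^e) = X modulo P, the same holds for every polynomial in X, that is for all q^(deg P)
    elements of F[X]/P, whereas X^(q^e) - X has at most q^e roots in that field. *)
Lemma irr_dvd_frobenius (P : {poly F}) e : monic_irreducible_poly P -> (0 < e)%N ->
  P %| 'X^(q ^ e) - 'X -> ((size P).-1 <= e)%N.
Proof.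
move=> PI e_gt0; rewrite -(resid_eq0 PI) => /eqP X0.
pose k := {poly %/ P with PI}.
have fixk (r : k) : r ^+ (q ^ e) = r.
  have /(congr1 (resid PI)) := @horner_card F _ (@polyC F) (val r) 'X e.
  rewrite -!/(comp_poly _ _) comp_polyXr rmorphXn /= resid_val => ->.
  have XX : resid PI ('X ^+ (q ^ e)) = resid PI 'X by apply/eqP; rewrite -subr_eq0 -rmorphB /= X0.
  by rewrite {1}/resid in_qpoly_comp_horner [in_qpoly P _]XX -in_qpoly_comp_horner comp_polyXr
    -[RHS]resid_val.
have q_gt1 : (1 < q ^ e)%N by rewrite -(exp1n e) ltn_exp2r ?finNzRing_gt1.
have sz : size ('X^(q ^ e) - 'X : {poly k}) = (q ^ e).+1.
  by rewrite size_polyDl ?size_polyXn // size_polyN size_polyX ltnS.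
have nz : 'X^(q ^ e) - 'X != 0 :> {poly k} by rewrite -size_poly_eq0 sz.
have := max_poly_roots nz _ (enum_uniq k); rewrite sz.
rewrite -cardE card_qfpoly ltnS leq_exp2l ?finNzRing_gt1 //; apply.
by apply/allP => r _; rewrite rootE !hornerE fixk subrr.
Qed.


Lemma irr_root_dvd (K : fieldType) (f : {rmorphism F -> K}) (P h : {poly F}) x :
  irreducible_poly P -> root (map_poly f P) x -> root (map_poly f h) x -> P %| h.
Proof.
move=> PI Px hx; apply: contraLR hx; rewrite -irreducible_poly_coprime // => cop.
by apply: coprimep_root Px; rewrite coprimep_map.
Qed.

(** The roots x^(q^j) with j < deg P are distinct: if x^(q^i) = x^(q^j) with i < j, then x is a root
    of X^(q^(j-i)) - X, so P divides it, against [irr_dvd_frobenius]. *)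
Lemma irr_root_factor (K : fieldType) (f : {rmorphism F -> K}) (P : {poly F}) x :
  monic_irreducible_poly P -> root (map_poly f P) x ->
  map_poly f P = \prod_(j < (size P).-1) ('X - (x ^+ (q ^ j))%:P).
Proof.
move=> PI Px; have P_mon := PI.2.
pose s := [seq x ^+ (q ^ j) | j <- iota 0 (size P).-1].
have fP_mon : map_poly f P \is monic by rewrite map_monic.
rewrite (@all_roots_prod_XsubC _ (map_poly f P) s).
- rewrite (monicP fP_mon) scale1r big_map -val_enum_ord big_map big_enum //=.
- by rewrite size_map_poly size_map size_iota prednK // size_poly_gt0 monic_neq0.
- apply/allP => _ /mapP[j _ ->]; rewrite rootE -(horner_card f).
  by rewrite (rootP Px) expr0n expn_eq0 eqn0Ngt (ltn_trans _ (finNzRing_gt1 F)).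
rewrite uniq_rootsE map_inj_in_uniq ?iota_uniq // => i j; rewrite !mem_iota /= !add0n.
wlog lt_ij : i j / (i < j)%N.
  move=> H ltin ltjn E; case: (ltngtP i j) => // [lt|lt]; first exact: H.
  by apply/esym/H.
move=> _ ltjn /eqP; rewrite -(subnK (ltnW lt_ij)) expnD exprM -subr_eq0.
rewrite -(exprN_card f) -(exprD_card f) expf_eq0 => /andP[_].
rewrite subr_eq0 => /eqP Ex; have := @irr_dvd_frobenius P (j - i) PI.
rewrite subn_gt0 lt_ij => /(_ isT) H.
suff /H : P %| 'X^(q ^ (j - i)) - 'X by rewrite leqNgt (leq_ltn_trans (leq_subr _ _) ltjn).
apply: (irr_root_dvd PI.1 Px).
by rewrite rootE rmorphB /= map_polyXn map_polyX !hornerE -Ex subrr.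
Qed.

(* Both sides are, up to sign, the resultant of [g] and [P]. *)
Lemma norm_reciprocity (K : fieldType) (f : {rmorphism F -> K}) (g P : {poly F}) x y :
  monic_irreducible_poly g -> monic_irreducible_poly P ->
  root (map_poly f P) x -> root (map_poly f g) y ->
  (map_poly f g).[x] ^+ (\sum_(j < (size P).-1) q ^ j) =
  (-1) ^+ ((size P).-1 * (size g).-1) * (map_poly f P).[y] ^+ (\sum_(i < (size g).-1) q ^ i).
Proof.
move=> gI PI Px gy; rewrite -!prodrXr.
rewrite (eq_bigr (fun j : 'I_(size P).-1 =>
    \prod_(i < (size g).-1) ((-1) * (y ^+ (q ^ i) - x ^+ (q ^ j))))); last first.
  move=> j _; rewrite (horner_card f) (irr_root_factor gI gy) horner_prod.
  by apply: eq_bigr => i _; rewrite hornerXsubC mulN1r opprB.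
rewrite [X in _ = _ * X](eq_bigr (fun i : 'I_(size g).-1 =>
    \prod_(j < (size P).-1) (y ^+ (q ^ i) - x ^+ (q ^ j)))); last first.
  move=> j _; rewrite (horner_card f) (irr_root_factor PI Px) horner_prod.
  by apply: eq_bigr => i _; rewrite hornerXsubC.
rewrite [in RHS]exchange_big /= mulnC exprM.
under eq_bigr => j _ do rewrite big_split /= prodr_const card_ord.
by rewrite big_split /= prodr_const card_ord.
Qed.

Lemma prod_irreds_dvd n (s : seq {poly F}) (H : {poly F}) : uniq s ->
  {subset s <= monic_irreds F n} -> {in s, forall P, P %| H} -> \prod_(P <- s) P %| H.
Proof.
elim: s => [|P s IHs] /=; first by rewrite big_nil dvd1p.
case/andP=> Ps us sub dvdH; rewrite big_cons Gauss_dvdp.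
  by rewrite dvdH ?mem_head //= IHs // => Q sQ; [apply: sub|apply: dvdH]; rewrite inE sQ orbT.
rewrite big_seq; elim/big_ind: _ => [|Q Q' ? ?|Q sQ]; first exact: coprimep1.
  by rewrite coprimepMr; apply/andP.
have /mem_monic_irreds [P_mon _ PI] := sub P (mem_head _ _).
have /mem_monic_irreds [Q_mon _ QI] : Q \in monic_irreds F n by apply: sub; rewrite inE sQ orbT.
by apply: monic_irred_coprime => //; apply: contraNneq Ps => ->.
Qed.

(** Distinct monic irreducible polynomials are coprime, so the product of those dividing H divides
    H; the bound compares degrees. *)
Lemma count_irreds_dvd n (H : {poly F}) : H != 0 ->
  (n * count (fun P : {poly F} => P %| H)%R (monic_irreds F n) <= (size H).-1)%N.
Proof.
move=> H0; rewrite -size_filter; set s := [seq _ <- _ | _].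
have us : uniq s by rewrite !filter_uniq ?uniq_monics.
have sub : {subset s <= monic_irreds F n} by move=> P; rewrite mem_filter => /andP[].
have /dvdp_leq : \prod_(P <- s) P %| H.
  by apply: (prod_irreds_dvd us sub) => P; rewrite mem_filter => /andP[].
move/(_ H0); have [_ ->] : \prod_(P <- s) P \is monic /\ size (\prod_(P <- s) P) = (n * size s).+1.
  elim: {us} s sub => [|P s IHs] sub.
    by rewrite big_nil monic1 size_poly1 muln0.
  have [|m_mon sm] := IHs; first by move=> Q sQ; apply: sub; rewrite inE sQ orbT.
  have /mem_monic_irreds [P_mon sP _] := sub P (mem_head _ _).
  rewrite big_cons rpredM // size_Mmonic ?monic_neq0 // sP sm; split=> //=.
  by rewrite addnS mulnS.
by case: (size H).
Qed.

(** The unit group modulo P has order q^n - 1. If the order of g is a proper divisor of it, then it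
    divides (q^n - 1) / r for a prime r dividing the index. *)
Lemma primitive_mod_irr (g P : {poly F}) n : monic_irreducible_poly P -> size P = n.+1 ->
  ~~ (P %| g) ->
  (forall r, prime r -> (r %| (q ^ n).-1)%N -> ~~ (P %| g ^+ ((q ^ n).-1 %/ r) - 1)) ->
  forall j, P %| g ^+ j - 1 -> ((q ^ n).-1 %| j)%N.
Proof.
move=> PI sP nPg prim j.
pose k := {poly %/ P with PI}.
have ug : resid PI g \is a GRing.unit by rewrite unitfE resid_eq0.
pose u := FinRing.unit k ug.
have dvdE i : (P %| g ^+ i - 1) = (u ^+ i == 1)%g.
  rewrite -(resid_eq0 PI) rmorphB rmorph1 rmorphXn subr_eq0.
  by rewrite -[RHS](inj_eq val_inj) FinRing.val_unitX.
have ord_dvd : (#[u]%g %| (q ^ n).-1)%N.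
  have := @order_dvdG _ [set: {unit k}]%G u; rewrite inE => /(_ isT).
  by rewrite card_finField_unit card_qfpoly sP.
have [e ee] := dvdnP ord_dvd.
have q_gt1 := finNzRing_gt1 F.
have m_gt0 : (0 < (q ^ n).-1)%N.
  have n_gt0 : (0 < n)%N by have := PI.1.1; rewrite sP.
  by rewrite -ltnS prednK ?expn_gt0 ?(ltnW q_gt1) // -(exp1n n) ltn_exp2r.
have [e1|e_gt1] := leqP e 1.
  have e1' : e = 1%N by move: m_gt0; rewrite ee; case: e e1 {ee} => [|[|]].
  by rewrite dvdE -order_dvdn ee e1' mul1n.
have r_e := pdiv_dvd e; have r_pr := pdiv_prime e_gt1.
have := prim _ r_pr; rewrite {1}ee dvdn_mulr // => /(_ isT).
by rewrite dvdE -order_dvdn ee -divn_mulAC // dvdn_mull.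
Qed.

End IrreducibleOverFiniteField.

(** * Artin's conjecture over a finite field *)

(** If r <= n, the prime n is coprime to r - 1, and q^n = q^(r-1) = 1 modulo r gives q = 1 modulo r
    by Bezout. *)
Lemma prime_dvd_pred_exp (q n r : nat) : (0 < q)%N -> prime n -> prime r ->
  (r %| (q ^ n).-1)%N -> ~~ (r %| q.-1)%N -> (n < r)%N.
Proof.
move=> q_gt0 pr_n pr_r; have r_gt1 := prime_gt1 pr_r.
have modE m : (0 < m)%N -> (r %| m.-1)%N = (m == 1 %[mod r])%N.
  by move=> m_gt0; rewrite eqn_mod_dvd ?subn1.
rewrite !modE ?expn_gt0 ?q_gt0 // => /eqP qn nq1; rewrite ltnNge; apply/negP => le_rn.
have cop_rq : coprime q r.
  rewrite coprime_sym prime_coprime //; apply/negP => rq; move: qn => /eqP.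
  rewrite -modnXm (eqP rq) exp0n ?prime_gt0 // mod0n modn_small //.
have qr : q ^ r.-1 = 1 %[mod r] by rewrite -(Euler_exp_totient cop_rq) totient_prime.
have r1_gt0 : (0 < r.-1)%N by rewrite -ltnS prednK // ltnW.
have cop_nr : coprime n r.-1.
  rewrite prime_coprime //; apply/negP => /(dvdn_leq r1_gt0).
  by rewrite leqNgt -ltnS prednK ?(ltnW r_gt1) // ltnS le_rn.
case/negP: nq1; have [u v uv _] := egcdnP r.-1 (prime_gt0 pr_n).
move: uv; rewrite (eqP cop_nr) => uv.
have : q ^ (u * n) = 1 %[mod r] by rewrite mulnC expnM -modnXm qn modnXm exp1n.
have qv : q ^ (v * r.-1) = 1 %[mod r] by rewrite mulnC expnM -modnXm qr modnXm exp1n.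
by rewrite uv expnD expn1 -modnMml qv modnMml mul1n => ->.
Qed.

Lemma exp_size_primes_le (n m : nat) (s : seq nat) : (0 < m)%N -> uniq s ->
  {in s, forall r, [/\ prime r, (n <= r)%N & (r %| m)%N]} -> (n ^ size s <= m)%N.
Proof.
move=> m_gt0 us sP; apply: (@leq_trans (\prod_(r <- s) r)).
  elim: s us sP => [|r s IHs] /= us sP; first by rewrite big_nil.
  rewrite big_cons expnS leq_mul //; first by case: (sP r (mem_head _ _)).
  by apply: IHs => [|t ts]; [case/andP: us | apply: sP; rewrite inE ts orbT].
apply: dvdn_leq => //; elim: s us sP => [|r s IHs] /=; first by rewrite big_nil dvd1n.
case/andP=> rs us sP; have [pr_r _ rm] := sP r (mem_head _ _).
rewrite big_cons Gauss_dvd; first by rewrite rm IHs // => t ts; apply: sP; rewrite inE ts orbT.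
rewrite big_seq; elim/big_ind: _ => [|a b|t ts]; first exact: coprimen1.
  by rewrite coprimeMr => -> ->.
have [pr_t _ _] : [/\ prime t, (n <= t)%N & (t %| m)%N] by apply: sP; rewrite inE ts orbT.
by rewrite prime_coprime // dvdn_prime2 //; apply: contraNneq rs => ->.
Qed.

Lemma count_le_sum_count (T I : eqType) (a : pred T) (b : I -> pred T) (s : seq T) (rs : seq I) :
  {in s, forall x, a x -> has (b^~ x) rs} ->
  (count a s <= \sum_(r <- rs) count (b r) s)%N.
Proof.
move=> cover; rewrite -sum1_count big_mkcond /=.
rewrite [leqRHS](eq_bigr (fun r => \sum_(x <- s) b r x)%N); last by move=> r _;
  rewrite -sum1_count big_mkcond.
rewrite exchange_big /= big_seq [leqRHS]big_seq leq_sum // => x xs.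
case: ifP => // ax; have /hasP[r rrs brx] := cover x xs ax.
by rewrite (big_rem r) //= brx.
Qed.

Section Artin.
Variables (F : finFieldType) (g : {poly F}) (gI : monic_irreducible_poly g).
Local Notation q := #|F|.
Local Notation d := (size g).-1.
Local Notation k := {poly %/ g with gI}.

(* [resid P = - zeta] makes the norm of [g] modulo [P] equal to the norm of [zeta], which
   generates the multiplicative group of [F]. *)
Lemma norm_primitive (zeta : {unit k}) (P : {poly F}) (n r : nat) :
  generator [set: {unit k}]%G zeta -> odd n -> P \in monic_irreds F n ->
  resid gI P = - val zeta -> prime r -> (r %| q.-1)%N ->
  ~~ (P %| g ^+ ((q ^ n).-1 %/ r) - 1).
Proof.
move=> gen odd_n /mem_monic_irreds [P_mon sP P_irr] Pz pr_r /dvdnP [e qe].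
have PI : monic_irreducible_poly P by split.
have q_gt1 := finNzRing_gt1 F.
have r_gt0 := prime_gt0 pr_r; have e_gt0 : (0 < e)%N by case: e qe => // q0; move: q_gt1;
  rewrite -ltn_predRL q0.
have [K [f _]] := countable_algebraic_closure F.
have rootK (h : {poly F}) : (1 < size h)%N -> {x | root (map_poly f h) x}.
  by move=> sh; apply/sigW/closed_rootP; rewrite size_map_poly neq_ltn sh orbT.
have [x Px] := rootK P P_irr.1; have [y gy] := rootK g gI.1.1.
pose S (m : nat) := (\sum_(i < m) q ^ i)%N.
apply/negP => /dvdpP [h] /(congr1 (fun p => (map_poly f p).[x])).
rewrite rmorphB rmorphM rmorphXn rmorph1 /= !hornerE (rootP Px) mulr0 ?horner_exp => /eqP.
have -> : ((q ^ n).-1 %/ r = S n * e)%N.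
  by rewrite predn_exp qe mulnAC mulnK // mulnC.
have recip := norm_reciprocity gI PI Px gy; rewrite sP /= in recip.
rewrite subr_eq0 exprM recip.
(* At a root y of g, the residue class of P gives P(y) = - zeta(y). *)
have [h' PE] : exists h', P = - val (val zeta) + h' * g.
  have : g %| P - (- val (val zeta)) by rewrite -(resid_eq0 gI) rmorphB rmorphN /= resid_val Pz
    subrr.
  by case/dvdpP => h' E; exists h'; rewrite -E addrC subrK.
rewrite {1}PE rmorphD rmorphN rmorphM /= hornerD hornerM (rootP gy) mulr0 addr0 hornerN.
rewrite -[X in X ^+ \sum_(_ < _) _]mulN1r [(-1 * _) ^+ _]exprMn.
(* Reciprocity contributes the sign (-1)^(n d) and the class of P the sign (-1)^d; they cancel as n
   is odd. *)
have -> : (-1) ^+ (\sum_(i < d) q ^ i) = (-1) ^+ d :> K.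
  rewrite -prodrXr (eq_bigr (fun _ => -1)) ?prodr_const ?card_ord // => i _.
  by rewrite (exprN_card f) expr1n.
rewrite mulrA -exprD -[X in (_ + X)%N]mul1n -mulnDl addn1 exprM.
rewrite -signr_odd /= odd_n expr0 expr1n mul1r -exprM => /eqP zy.
have : g %| val (val zeta) ^+ (S d * e) - 1.
  apply: (irr_root_dvd gI.1 gy); rewrite rootE rmorphB rmorphXn rmorph1 /= !hornerE ?horner_exp.
  by rewrite zy subrr.
rewrite -(resid_eq0 gI) rmorphB rmorphXn rmorph1 /= resid_val subr_eq0.
have -> : (val zeta ^+ (S d * e) == 1) = (zeta ^+ (S d * e) == 1)%g.
  by rewrite -[RHS](inj_eq val_inj) FinRing.val_unitX.
(* The order of [zeta] is q^d - 1 = S(d) e r, which cannot divide the smaller number S(d) e. *)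
rewrite -order_dvdn /order -(eqP gen) card_finField_unit card_qfpoly predn_exp qe -/(S d).
have S_gt0 : (0 < S d)%N.
  by rewrite /S; have := gI.1.1; case: (size g) => [|[|m]] // _; rewrite big_ord_recl.
move/dvdn_leq; rewrite muln_gt0 S_gt0 e_gt0 => /(_ isT).
rewrite [(S d * e)%N]mulnC mulnAC -[leqRHS]muln1 leq_pmul2l ?muln_gt0 ?e_gt0 //.
by rewrite leqNgt prime_gt1.
Qed.

(** For a large prime n, at least q^n / (4 Q n) irreducible P of degree n lie in the class of -
    [zeta]. Those failing at a prime r in [rs] divide g^(m/r) - 1, of degree at most d m / n, so
    there are at most d m / n^2 of them for each r. As [rs] is short, some P survives. *)
Theorem artin_primitive_root (B : nat) : exists P : {poly F},
  [/\ monic_irreducible_poly P, (B < size P)%N &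
      forall j, P %| g ^+ j - 1 -> ((q ^ (size P).-1).-1 %| j)%N].
Proof.
have q_gt1 := finNzRing_gt1 F.
have /cyclicP [zeta zetaE] := field_unit_group_cyclic [set: {unit k}]%G.
have gen : generator [set: {unit k}]%G zeta by rewrite /generator zetaE.
pose a : {poly F} := - val (val zeta).
have aE : resid gI a = - val zeta by rewrite rmorphN /= resid_val.
have na : ~~ (g %| a) by rewrite -(resid_eq0 gI) aE oppr_eq0 -unitfE (valP zeta).
have [N NE] := monic_irreds_in_class gI na.
pose Q := #|k|; pose C := (4 * Q * d)%N.
(* The summands put n beyond [B], into the range of the count, above q^C, above d so that P differs
   from [g], and above 2 so that n is odd. *)
have [n] := prime_above (B + N + q ^ C + d + 2)%N.
have qC_gt0 : (0 < q ^ C)%N by rewrite expn_gt0 ltnW.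
move=> lt_n pr_n; have n_gt1 := prime_gt1 pr_n.
have lt_dn : (d < n)%N by lia.
have odd_n : odd n.
  by have [n2|//] := even_prime pr_n; move: lt_n; rewrite n2; lia.
have le_Nn : (N <= n)%N by lia.
have lt_qC : (q ^ C < n)%N by lia.
have cntE := NE n le_Nn pr_n; set cnt := count _ _ in cntE.
pose m := (q ^ n).-1.
have m_gt0 : (0 < m)%N.
  by rewrite -ltnS prednK ?expn_gt0 ?(ltnW q_gt1) // -(exp1n n) ltn_exp2r ?prime_gt0.
pose rs := [seq r <- primes m | ~~ (r %| q.-1)%N].
have rsP r : r \in rs -> [/\ prime r, (n < r)%N & (r %| m)%N].
  rewrite mem_filter mem_primes => /andP[nr /and3P[pr_r _ rm]]; split=> //.
  by apply: prime_dvd_pred_exp rm nr => //; apply: ltnW.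
have ndvd_g (P : {poly F}) : P \in monic_irreds F n -> ~~ (P %| g).
  case/mem_monic_irreds => P_mon sP P_irr; rewrite (monic_irred_dvd P_mon gI.2 P_irr gI.1).
  by apply: contraTneq lt_dn => <-; rewrite sP /= ltnn.
have [/hasP [P Pn /andP[/eqP Pa Pgood]]|] := boolP (has (fun P =>
    (resid gI P == resid gI a) && all (fun r => ~~ (P %| g ^+ (m %/ r) - 1)) rs) (monic_irreds F
      n)).
  have /mem_monic_irreds [P_mon sP P_irr] := Pn.
  have PI : monic_irreducible_poly P by split.
  exists P; split=> //; first by rewrite sP; lia.
  rewrite sP /=; apply: (primitive_mod_irr PI sP); first exact: ndvd_g.
  move=> r pr_r rm; have [rq|nrq] := boolP (r %| q.-1)%N.
    by apply: norm_primitive gen odd_n Pn _ pr_r rq; rewrite Pa.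
  apply: (allP Pgood); rewrite mem_filter nrq mem_primes pr_r rm /=.
  by rewrite m_gt0.
move/hasPn => allbad; exfalso.
have le_cnt : (cnt <= \sum_(r <- rs) count (fun P : {poly F} => P %| g ^+ (m %/ r) - 1)%R
  (monic_irreds F n))%N.
  apply: count_le_sum_count => P /allbad; rewrite negb_and => bad Pa.
  move: bad; rewrite Pa /= -has_predC => /hasP [r rrs /=]; rewrite negbK => Pr.
  by apply/hasP; exists r.
have le_r r : r \in rs -> (n * n * count (fun P : {poly F} => P %| g ^+ (m %/ r) - 1)%R
  (monic_irreds F n) <= d * m)%N.
  case/rsP => pr_r lt_nr rm.
  have g_gt1 : (1 < size g)%N := gI.1.1.
  have mr_gt0 : (0 < m %/ r)%N by rewrite divn_gt0 ?prime_gt0 // dvdn_leq.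
  have sH : size (g ^+ (m %/ r) - 1) = (d * (m %/ r)).+1.
    have sX : size (g ^+ (m %/ r)) = (d * (m %/ r)).+1.
      by apply: size_monic_exp; [apply: gI.2|rewrite prednK // ltnW].
    rewrite size_polyDl sX // size_polyN size_poly1 ltnS muln_gt0 mr_gt0 andbT.
    by rewrite -ltnS prednK // ltnW.
  have H0 : g ^+ (m %/ r) - 1 != 0 by rewrite -size_poly_eq0 sH.
  have := count_irreds_dvd n H0; rewrite sH /=; set c := count _ _ => le_c.
  rewrite -[in leqRHS](divnK rm) mulnA -mulnA [(n * (n * c))%N]mulnC.
  by rewrite leq_mul // ltnW.
have le_c : (n ^ size rs <= m)%N.
  apply: exp_size_primes_le => //; first by rewrite filter_uniq ?primes_uniq.
  by move=> r /rsP [? /ltnW ? ?]; split.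
(* If n <= C [size rs], then n^n <= (n^(size rs))^C <= q^(n C), against n > q^C. *)
have lt_c : (C * size rs < n)%N.
  rewrite ltnNge; apply/negP => le_n.
  have : (n ^ n <= (q ^ C) ^ n)%N.
    apply: (@leq_trans (n ^ (C * size rs))); first by rewrite leq_exp2l.
    rewrite mulnC expnM -[leqRHS]expnM [(C * n)%N]mulnC expnM leq_exp2r.
      by rewrite (leq_trans le_c) // leq_pred.
    by move: le_n; case: (C) => //; rewrite mul0n leqn0 => /eqP n0; rewrite n0 in n_gt1.
  by rewrite leqNgt ltn_exp2r ?prime_gt0 // lt_qC.
have le_sum : (n * n * cnt <= size rs * (d * m))%N.
  apply: leq_trans (_ : n * n * (\sum_(r <- rs) count (fun P : {poly F} => P %| g ^+ (m %/ r) -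
    1)%R (monic_irreds F n)) <= _)%N.
    by rewrite leq_mul2l le_cnt orbT.
  rewrite big_distrr /= big_seq; apply: leq_trans (_ : \sum_(r <- rs) d * m <= _)%N.
    by rewrite [leqRHS]big_seq; apply: leq_sum => r /le_r.
  by rewrite big_const_seq count_predT iter_addn_0 mulnC.
have le_m : (m <= q ^ n)%N by apply: leq_pred.
have : (n * n * cnt <= size rs * d * (4 * Q * (n * cnt)))%N.
  by rewrite (leq_trans le_sum) // mulnA leq_mul2l (leq_trans le_m cntE) orbT.
have -> : (size rs * d * (4 * Q * (n * cnt)) = C * size rs * (n * cnt))%N by rewrite /C; nia.
rewrite -mulnA leq_pmul2r; first by rewrite leqNgt lt_c.
rewrite lt0n; apply: contraTneq cntE => ->; rewrite muln0 -ltnNge expn_gt0.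
by rewrite ltnW.
Qed.
End Artin.

(** * The Carlitz module *)

Section CarlitzModule.
Variable F : finFieldType.
Local Notation q := #|F|.

(** The coefficient of tau^i in (t + tau)^k, where tau is the q-power map, so that tau c = c^q
    tau. *)
Fixpoint carlitz_coef_X (k i : nat) : {poly F} :=
  if k is k'.+1 then
    'X * carlitz_coef_X k' i + (if i is i'.+1 then carlitz_coef_X k' i' ^+ q else 0)
  else (i == 0%N)%:R.

(** The coefficient of x^(q^i) in rho_M(x). *)
Definition carlitz_coef (M : {poly F}) (i : nat) : {poly F} :=
  \sum_(k < size M) M`_k *: carlitz_coef_X k i.

Lemma carlitz_coef_X_gt k i : (k < i)%N -> carlitz_coef_X k i = 0.
Proof.
elim: k i => [|k IHk] [|i] //= lt_ki; rewrite IHk ?(ltn_trans _ lt_ki) // mulr0 add0r.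
by rewrite IHk // expr0n eqn0Ngt (ltn_trans _ (finNzRing_gt1 F)).
Qed.

Lemma carlitz_coef_X_diag k : carlitz_coef_X k k = 1.
Proof. by elim: k => //= k IHk; rewrite carlitz_coef_X_gt // IHk mulr0 add0r expr1n. Qed.

Lemma carlitz_coef_X0 k : carlitz_coef_X k 0 = 'X^k.
Proof. by elim: k => //= k ->; rewrite addr0 exprS. Qed.

(* The two ways of expanding [rho_t o rho_(t^k) = rho_(t^k) o rho_t]. *)
Lemma carlitz_coef_X_comm k i : ('X^(q ^ i.+1) - 'X) * carlitz_coef_X k i.+1 =
  carlitz_coef_X k i ^+ q - carlitz_coef_X k i.
Proof.
have frobB (x y : {poly F}) : (x - y) ^+ q = x ^+ q - y ^+ q.
  by have := exprD_card (@polyC F) x (- y) 1; rewrite expn1 => ->;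
    have := exprN_card (@polyC F) y 1; rewrite expn1 => ->.
have frobD (x y : {poly F}) : (x + y) ^+ q = x ^+ q + y ^+ q.
  by have := exprD_card (@polyC F) x y 1; rewrite expn1.
elim: k i => [|k IHk] i /=.
  rewrite mulr0; case: i => [|i] /=; first by rewrite expr1n subrr.
  by rewrite expr0n eqn0Ngt (ltn_trans _ (finNzRing_gt1 F)) // subrr.
rewrite mulrDr mulrCA IHk; case: i => [|i].
  rewrite expn1 addr0 exprMn !carlitz_coef_X0 -!exprM; ring.
rewrite frobD exprMn expnSr exprM.
have := congr1 (fun z => z ^+ q) (IHk i); rewrite exprMn !frobB => H.
rewrite -[X in _ = X - _](subrK (carlitz_coef_X k i ^+ q)) -addrA.
rewrite -[_ + _ - carlitz_coef_X k i ^+ q]addrA -H.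
move: ('X^(q ^ i.+1) ^+ q) => Y; ring.
Qed.

Lemma carlitz_coef_comm M i : ('X^(q ^ i.+1) - 'X) * carlitz_coef M i.+1 =
  carlitz_coef M i ^+ q - carlitz_coef M i.
Proof.
have := @expr_sum_card F _ (@polyC F) _ (index_enum 'I_(size M)) predT
  (fun k : 'I_(size M) => M`_k *: carlitz_coef_X k i) 1; rewrite expn1 => ->.
rewrite -sumrB mulr_sumr; apply: eq_bigr => k _.
by rewrite exprZn expf_card -scalerBr -carlitz_coef_X_comm scalerAr.
Qed.

Lemma carlitz_coef0 M : carlitz_coef M 0 = M.
Proof.
rewrite -[RHS]coefK poly_def; apply: eq_bigr => k _.
by rewrite carlitz_coef_X0.
Qed.

Lemma carlitz_coef_lead (M : {poly F}) n : size M = n.+1 -> carlitz_coef M n = (lead_coef M)%:P.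
Proof.
move=> sM; rewrite /carlitz_coef lead_coefE sM big_ord_recr /= carlitz_coef_X_diag.
rewrite big1 ?add0r ?alg_polyC // => k _.
by rewrite carlitz_coef_X_gt ?scaler0.
Qed.

(** In [carlitz_coef_comm] the factor X^(q^(i+1)) - X is coprime to M while i + 1 < deg M, so
    divisibility passes from i to i + 1, starting from the coefficient M at 0. Thus rho_M is the
    q^(deg M)-power map modulo M. *)
Lemma dvdp_carlitz_coef (M : {poly F}) i : monic_irreducible_poly M -> (i < (size M).-1)%N ->
  M %| carlitz_coef M i.
Proof.
move=> MI; elim: i => [|i IHi] lt_i; first by rewrite carlitz_coef0.
have {}IHi := IHi (ltnW lt_i).
have : M %| ('X^(q ^ i.+1) - 'X) * carlitz_coef M i.+1.
  by rewrite carlitz_coef_comm dvdp_sub ?dvdp_exp // (ltn_trans _ (finNzRing_gt1 F)).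
rewrite Gauss_dvdpr // irreducible_poly_coprime; last exact: MI.1.
by apply/negP => /(irr_dvd_frobenius MI (ltn0Sn i)); rewrite leqNgt lt_i.
Qed.

Section Action.
Variables (R : comNzRingType) (phi : {rmorphism {poly F} -> R}).

Definition carlitz_var (x : R) : R := phi 'X * x + x ^+ q.

(* [carlitz] over an arbitrary commutative ring, in order to reduce the action modulo primes. *)
Definition carlitz_act (M : {poly F}) (x : R) : R :=
  \sum_(i < size M) phi (M`_i)%:P * iter i carlitz_var x.

Let phiC : {rmorphism F -> R} := [the {rmorphism F -> R} of phi \o polyC].

Lemma carlitz_frobD e (x y : R) : (x + y) ^+ (q ^ e) = x ^+ (q ^ e) + y ^+ (q ^ e).
Proof. exact: (exprD_card phiC). Qed.

Lemma carlitz_actE (M : {poly F}) N x : (size M <= N)%N ->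
  carlitz_act M x = \sum_(i < N) phi (carlitz_coef M i) * x ^+ (q ^ i).
Proof.
move=> le_N.
have iterE k n : (k < n)%N -> iter k carlitz_var x = \sum_(i < n) phi (carlitz_coef_X k i) * x ^+
  (q ^ i).
  elim: k n => [|k IHk] [|n] // lt_kn.
    rewrite big_ord_recl /= rmorph1 mul1r expn0 expr1 big1 ?addr0 // => i _.
    by rewrite rmorph0 mul0r.
  rewrite iterS /carlitz_var {1}(IHk n.+1) ?(ltnW lt_kn) // (IHk n) //.
  have := @expr_sum_card F _ phiC _ (index_enum 'I_n) predT
    (fun i : 'I_n => phi (carlitz_coef_X k i) * x ^+ (q ^ i)) 1; rewrite expn1 => ->.
  rewrite big_ord_recl [in RHS]big_ord_recl /= addr0 mulrDr mulr_sumr -addrA -big_split /=.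
  congr (_ + _); first by rewrite rmorphM mulrA.
  apply: eq_bigr => i _; rewrite rmorphD rmorphM rmorphXn mulrDl mulrA; congr (_ + _).
  by rewrite exprMn -exprM -expnSr.
rewrite /carlitz_act (eq_bigr (fun k : 'I_(size M) => \sum_(i < N)
    phi (M`_k *: carlitz_coef_X k i) * x ^+ (q ^ i))); last first.
  move=> k _; rewrite (iterE _ N) ?(leq_trans (ltn_ord k)) // mulr_sumr.
  by apply: eq_bigr => i _; rewrite -mul_polyC rmorphM mulrA.
by rewrite exchange_big; apply: eq_bigr => i _; rewrite rmorph_sum mulr_suml.
Qed.

Lemma carlitz_act0 M : carlitz_act M 0 = 0.
Proof.
rewrite (carlitz_actE _ (leqnn _)) big1 // => i _.
by rewrite expr0n expn_eq0 eqn0Ngt (ltn_trans _ (finNzRing_gt1 F)) // mulr0.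
Qed.

Lemma carlitz_actB M x y : carlitz_act M (x - y) = carlitz_act M x - carlitz_act M y.
Proof.
rewrite !(carlitz_actE _ (leqnn _)) -sumrB; apply: eq_bigr => i _.
by rewrite carlitz_frobD (exprN_card phiC) mulrBr.
Qed.

Lemma carlitz_act_poly0 x : carlitz_act 0 x = 0.
Proof. by rewrite /carlitz_act size_poly0 big_ord0. Qed.

Lemma carlitz_act1 x : carlitz_act 1 x = x.
Proof. by rewrite /carlitz_act size_poly1 big_ord1 coefC eqxx rmorph1 mul1r. Qed.

Lemma carlitz_act_widen (M : {poly F}) N x : (size M <= N)%N ->
  carlitz_act M x = \sum_(i < N) phi (M`_i)%:P * iter i carlitz_var x.
Proof.
move=> le_N; rewrite /carlitz_act (big_ord_widen _ (fun i => phi (M`_i)%:P * iter i carlitz_var x)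
  le_N).
rewrite big_mkcond; apply: eq_bigr => i _; case: ltnP => // le_i.
by rewrite nth_default // polyC0 rmorph0 mul0r.
Qed.

Lemma carlitz_act_polyB M N x : carlitz_act (M - N) x = carlitz_act M x - carlitz_act N x.
Proof.
pose n := maxn (size M) (size N).
have le_n : (size (M - N)%R <= n)%N by rewrite (leq_trans (size_polyD _ _)) // size_polyN.
rewrite (carlitz_act_widen _ le_n) !(@carlitz_act_widen _ n) ?leq_maxl ?leq_maxr //.
by rewrite -sumrB; apply: eq_bigr => i _; rewrite coefB polyCB rmorphB mulrBl.
Qed.

Lemma carlitz_act_cons M c x : carlitz_act (M * 'X + c%:P) x = carlitz_act M (carlitz_var x) + phi
  c%:P * x.
Proof.
have le_n : (size (M * 'X + c%:P)%R <= (size M).+1)%N.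
  by rewrite size_MXaddC; case: ifP.
rewrite (carlitz_act_widen _ le_n) big_ord_recl addrC coefD coefMX coefC /= add0r; congr (_ + _).
by apply: eq_bigr => i _; rewrite coefD coefMX coefC /= addr0 -iterSr.
Qed.

Lemma carlitz_actM M N x : carlitz_act (M * N) x = carlitz_act M (carlitz_act N x).
Proof.
have polyD U V y : carlitz_act (U + V) y = carlitz_act U y + carlitz_act V y.
  by rewrite -[V in U + V]opprK -[- V]sub0r !carlitz_act_polyB carlitz_act_poly0 sub0r opprK.
(* rho_U commutes with rho_t, because the coefficients of U lie in F and are fixed by the q-power
   map. *)
have varN U y : carlitz_act U (carlitz_var y) = carlitz_var (carlitz_act U y).
  have varE z : carlitz_var z = phi 'X * z + z ^+ q by [].
  rewrite /carlitz_act [RHS]varE mulr_sumr.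
  have := @expr_sum_card F _ phiC _ (index_enum 'I_(size U)) predT
    (fun i : 'I_(size U) => phi (U`_i)%:P * iter i carlitz_var y) 1; rewrite expn1 => ->.
  rewrite -big_split /=; apply: eq_bigr => i _; rewrite -iterSr iterS varE mulrDr.
  by rewrite mulrCA exprMn -rmorphXn -[in RHS]rmorphXn expf_card.
elim/poly_ind: M N x => [|M c IHM] N x; first by rewrite mul0r !carlitz_act_poly0.
rewrite carlitz_act_cons mulrDl polyD -mulrA [_ * N]mulrC IHM; congr (_ + _).
  by rewrite -[N * _]addr0 carlitz_act_cons rmorph0 mul0r addr0 varN.
rewrite mul_polyC (carlitz_act_widen _ (size_scale_leq _ _)) mulr_sumr.
by apply: eq_bigr => i _; rewrite coefZ polyCM rmorphM mulrA.
Qed.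

End Action.

End CarlitzModule.

(** * The Carlitz cyclotomic polynomial *)

Section CarlitzCyclotomicPolynomial.
Variables (F : finFieldType) (M : {poly F}).
Local Notation q := #|F|.
Local Notation n := (size M).-1.
Local Notation m := (q ^ n).-1.

(** This is rho_M(x) / x as a polynomial in x, whence the exponents q^i - 1. For irreducible M its
    roots are the nonzero M-torsion points. *)
Definition carlitz_cyclo : {poly {poly F}} :=
  \sum_(i < size M) carlitz_coef M i *: 'X^((q ^ i).-1).

Lemma carlitz_cyclo_act (R : comNzRingType) (phi : {rmorphism {poly F} -> R}) x :
  x * (map_poly phi carlitz_cyclo).[x] = carlitz_act phi M x.
Proof.
rewrite (carlitz_actE _ _ (leqnn _)) rmorph_sum horner_sum mulr_sumr.
apply: eq_bigr => i _; rewrite /= map_polyZ map_polyXn hornerZ hornerXn mulrCA -exprS prednK //.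
by rewrite expn_gt0 (ltn_trans _ (finNzRing_gt1 F)).
Qed.

Hypothesis MI : monic_irreducible_poly M.

Lemma size_carlitz_modulus : size M = n.+1.
Proof. by rewrite prednK // ltnW // MI.1.1. Qed.

Lemma carlitz_cyclo_deg_gt0 : (0 < m)%N.
Proof.
have n_gt0 : (0 < n)%N by have := MI.1.1; rewrite size_carlitz_modulus.
by rewrite -ltnS prednK ?expn_gt0 ?(ltn_trans _ (finNzRing_gt1 F)) // -(exp1n n) ltn_exp2r
  ?finNzRing_gt1.
Qed.

(** The Eisenstein shape at M: by [dvdp_carlitz_coef], M divides all coefficients below the leading
    1, and the constant one is M itself. *)
Lemma carlitz_cycloE : exists2 lo : {poly {poly F}}, carlitz_cyclo = 'X^m + M *: lo &
  (size lo <= m)%N /\ lo`_0 = 1.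
Proof.
have n_gt0 : (0 < n)%N by have := MI.1.1; rewrite size_carlitz_modulus.
have q_gt1 := finNzRing_gt1 F.
exists (\sum_(i < n) (carlitz_coef M i %/ M) *: 'X^((q ^ i).-1)).
  rewrite /carlitz_cyclo size_carlitz_modulus big_ord_recr /= (carlitz_coef_lead
    size_carlitz_modulus) (monicP MI.2).
  rewrite scale1r addrC scaler_sumr; congr (_ + _); apply: eq_bigr => i _.
  by rewrite scalerA mulrC divpK // dvdp_carlitz_coef.
split.
  apply: leq_trans (size_sum _ _ _) _; apply/bigmax_leqP => i _.
  apply: leq_trans (size_scale_leq _ _) _; rewrite size_polyXn prednK ?expn_gt0 ?(ltnW q_gt1) //.
  by rewrite -ltnS prednK ?expn_gt0 ?(ltnW q_gt1) // ltn_exp2l.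
rewrite coef_sum (bigD1 (Ordinal n_gt0)) //= carlitz_coef0 divpp ?monic_neq0 ?MI.2 //.
rewrite coefZ coefXn mulr1 big1 ?addr0 // => i i0; rewrite coefZ coefXn.
case: eqP => [/esym/eqP|]; last by rewrite mulr0.
have i_gt0 : (0 < i)%N by rewrite lt0n; apply: contraNneq i0 => E; apply/eqP/val_inj.
by rewrite -leqn0 leqNgt -ltnS prednK ?expn_gt0 ?(ltnW q_gt1) // -(exp1n i) ltn_exp2r ?q_gt1.
Qed.

Lemma size_carlitz_cyclo : size carlitz_cyclo = m.+1.
Proof.
have [lo -> [slo _]] := carlitz_cycloE; rewrite size_polyDl size_polyXn //.
by rewrite ltnS (leq_trans (size_scale_leq _ _)).
Qed.

Lemma carlitz_cyclo_monic : carlitz_cyclo \is monic.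
Proof.
have [lo -> [slo _]] := carlitz_cycloE; rewrite monicE lead_coefDl ?lead_coefXn //.
by rewrite size_polyXn ltnS (leq_trans (size_scale_leq _ _)).
Qed.

Lemma carlitz_cyclo_coef0 : carlitz_cyclo`_0 = M.
Proof.
have [lo -> [_ lo0]] := carlitz_cycloE.
by rewrite coefD coefXn coefZ lo0 mulr1 eq_sym eqn0Ngt carlitz_cyclo_deg_gt0 add0r.
Qed.

(** If M does not divide a, a Bezout relation u M + v a = 1 shows that rho_1 kills z, so z = 0. *)
Lemma carlitz_annihilator (K : fieldType) (phi : {rmorphism {poly F} -> K}) (a : {poly F}) z :
  z != 0 -> carlitz_act phi M z = 0 -> carlitz_act phi a z = 0 -> M %| a.
Proof.
move=> z0 Mz az; apply: contraNT z0; rewrite -irreducible_poly_coprime; last exact: MI.1.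
case/Bezout_eq1_coprimepP => -[u v] /= uv.
rewrite -(carlitz_act1 phi z) -uv -[v * a]opprK carlitz_act_polyB -mulNr !carlitz_actM Mz az.
by rewrite !carlitz_act0 subrr.
Qed.

(** * Irreducibility of the cyclotomic polynomial modulo an inert prime *)

Section ModuloPrime.
Variables (P : {poly F}) (PI : monic_irreducible_poly P).
Hypothesis primitive : forall j, M %| P ^+ j - 1 -> (m %| j)%N.
Hypothesis nPM : ~~ (P %| M).
Local Notation k := {poly %/ P with PI}.

Lemma size_carlitz_cyclo_mod : size (map_poly (resid PI) carlitz_cyclo) = m.+1.
Proof.
by rewrite size_map_poly_id0 ?size_carlitz_cyclo // (monicP carlitz_cyclo_monic) rmorph1 oner_eq0.
Qed.

(* The Frobenius [z |-> z ^ #|k|] acts on the torsion modulo [P] as [rho_P], so the orbit of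
   a root of a factor has [m] elements. *)
Lemma carlitz_cyclo_irr_mod : irreducible_poly (map_poly (resid PI) carlitz_cyclo).
Proof.
set Phi := map_poly _ _; have sPhi : size Phi = m.+1 := size_carlitz_cyclo_mod.
have Phi0 : Phi != 0 by rewrite -size_poly_eq0 sPhi.
split; first by rewrite sPhi ltnS carlitz_cyclo_deg_gt0.
move=> h h1 hPhi; have h0 : h != 0 by apply: contraNneq Phi0 => h0; rewrite h0 dvd0p in hPhi.
have [K [f _]] := countable_algebraic_closure k.
have [z hz] : {z | root (map_poly f h) z}.
  by apply/sigW/closed_rootP; rewrite size_map_poly.
pose psi : {rmorphism {poly F} -> K} := [the {rmorphism {poly F} -> K} of f \o resid PI].
have Mz : carlitz_act psi M z = 0.
  have E : map_poly psi carlitz_cyclo = map_poly f Phi by rewrite -map_poly_comp.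
  rewrite -carlitz_cyclo_act E; have /dvdpP [h' ->] := hPhi.
  by rewrite rmorphM /= hornerM (rootP hz) !mulr0.
pose Q := #|k|.
have QE : Q = (q ^ (size P).-1)%N := card_qfpoly PI.
(* Modulo P only the leading term of rho_P survives. *)
have Pact x : carlitz_act psi P x = x ^+ Q.
  have sP : size P = (size P).-1.+1 by rewrite prednK // ltnW // PI.1.1.
  have le_sP : (size P <= (size P).-1.+1)%N by rewrite -sP.
  rewrite (carlitz_actE _ _ le_sP) big_ord_recr /=.
  rewrite (carlitz_coef_lead sP) (monicP PI.2) !rmorph1 mul1r -QE big1 ?add0r // => i _.
  have /eqP -> : resid PI (carlitz_coef P i) == 0 by rewrite resid_eq0 dvdp_carlitz_coef.
  by rewrite rmorph0 mul0r.
have PXact i x : carlitz_act psi (P ^+ i) x = x ^+ (Q ^ i).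
  elim: i x => [|i IHi] x; first by rewrite carlitz_act1.
  by rewrite exprSr carlitz_actM IHi Pact -exprM expnS.
have Q_gt1 : (1 < Q)%N := finNzRing_gt1 k.
(* A root 0 would make the constant coefficient M vanish modulo P. *)
have z0 : z != 0.
  apply: contraNneq nPM => z0; rewrite -(resid_eq0 PI) -carlitz_cyclo_coef0.
  have Phi00 : Phi.[0] = 0.
    have /dvdpP [h' ->] := hPhi; rewrite hornerM; have := hz; rewrite z0 rootE.
    by rewrite -(rmorph0 f) horner_map (inj_eq (fmorph_inj f)) => /eqP ->; rewrite mulr0.
  by rewrite -coef_map -horner_coef0 Phi00.
rewrite -dvdp_size_eqp // eqn_leq dvdp_leq //=.
pose s := [seq z ^+ (Q ^ i) | i <- iota 0 m].
have hf0 : map_poly f h != 0 by rewrite map_poly_eq0.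
have := max_poly_roots hf0 (_ : all (root (map_poly f h)) s).
rewrite size_map_poly size_map size_iota sPhi; apply.
  apply/allP => _ /mapP[i _ ->]; rewrite rootE -(horner_card f) (rootP hz).
  by rewrite expr0n expn_eq0 eqn0Ngt (ltn_trans _ Q_gt1).
rewrite map_inj_in_uniq ?iota_uniq // => i j; rewrite !mem_iota /= !add0n.
wlog lt_ij : i j / (i < j)%N.
  move=> H lti ltj E; case: (ltngtP i j) => // [lt|lt]; first exact: H.
  by apply/esym/H.
move=> _ lt_jm /eqP; rewrite -(subnK (ltnW lt_ij)) expnD exprM -subr_eq0.
rewrite -(exprN_card f) -(exprD_card f) expf_eq0 => /andP[_]; rewrite subr_eq0 => /eqP Ez.
(* A repetition in the orbit gives a zero of rho_(P^(j-i) - 1) at z, so M divides P^(j-i) - 1 and m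
   divides j - i, which is less than m. *)
have /primitive /dvdn_leq : M %| P ^+ (j - i) - 1.
  apply: (carlitz_annihilator z0 Mz).
  by rewrite carlitz_act_polyB PXact carlitz_act1 -Ez subrr.
rewrite subn_gt0 lt_ij => /(_ isT); rewrite leqNgt.
by rewrite (leq_ltn_trans (leq_subr _ _) lt_jm).
Qed.

(** Modulo P, f is nonzero and of smaller degree than an irreducible polynomial, hence coprime to
    it. Lifting the Bezout relation coefficientwise leaves an error divisible by P. *)
Lemma carlitz_cyclo_bezout (f : {poly {poly F}}) : (size f <= m)%N ->
  ~~ (map_poly (resid PI) f == 0) ->
  exists u v w, u * f + v * carlitz_cyclo = 1 + P *: w.
Proof.
move=> sf nf; have Phi_irr := carlitz_cyclo_irr_mod.
have : coprimep (map_poly (resid PI) f) (map_poly (resid PI) carlitz_cyclo).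
  rewrite coprimep_sym irreducible_poly_coprime //.
  apply: contra nf => /dvdp_leq; case: eqP => // _ /(_ isT).
  by rewrite size_carlitz_cyclo_mod leqNgt ltnS (leq_trans (size_poly _ _) sf).
case/Bezout_eq1_coprimepP => -[u v] /= uv.
pose lift (p : {poly k}) : {poly {poly F}} := map_poly (val : k -> {poly F}) p.
have liftK p : map_poly (resid PI) (lift p) = p.
  rewrite -map_poly_comp_id0 ?resid_val //; last exact: rmorph0.
  by apply: map_poly_id => x _; rewrite /= resid_val.
pose G := lift u * f + lift v * carlitz_cyclo - 1.
have E : map_poly (resid PI) G = 0.
  by rewrite rmorphB rmorphD !rmorphM rmorph1 /= !liftK uv subrr.
exists (lift u), (lift v), (\poly_(i < size G) (G`_i %/ P)).
rewrite -[LHS](subrK 1) addrC -/G; congr (_ + _).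
apply/polyP => i; rewrite coefZ coef_poly.
case: ltnP => [lt_i|le_i]; last by rewrite mulr0 nth_default.
by rewrite mulrC divpK // -(resid_eq0 PI) -coef_map E coef0.
Qed.




End ModuloPrime.
End CarlitzCyclotomicPolynomial.

(** * The ring of integers of a cyclotomic function field *)

(** The rational root argument: for b / a in lowest terms, a monic equation of degree k gives a |
    b^k, so a is constant. *)
Lemma integrally_closed_poly (F : fieldType) (L : fieldType) (phi : {rmorphism {poly F} -> L})
  (a b : {poly F}) x : injective phi -> a != 0 -> integralOver phi x -> phi a * x = phi b ->
  exists c, x = phi c.
Proof.
move=> phi_inj; wlog cop : a b / coprimep a b.
  move=> H a0 xint E; pose D := gcdp a b.
  have D0 : D != 0 by rewrite gcdp_eq0 (negbTE a0).
  have phiD0 : phi D != 0 by rewrite -(rmorph0 phi) (inj_eq phi_inj).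
  apply: (H (a %/ D) (b %/ D)) => //.
  - by apply: coprimep_div_gcd; rewrite a0.
  - by rewrite divp_eq0 (negbTE a0) (negbTE D0) /= -leqNgt dvdp_leq ?dvdp_gcdl.
  apply: (mulIf phiD0); rewrite mulrAC -!rmorphM !divpK ?dvdp_gcdl ?dvdp_gcdr //.
move=> a0 [p p_mon px] E.
have phia0 : phi a != 0 by rewrite -(rmorph0 phi) (inj_eq phi_inj).
have [k sp] : exists k, size p = k.+1.
  by exists (size p).-1; rewrite prednK // size_poly_gt0 monic_neq0.
have : \sum_(i < k.+1) p`_i * (b ^+ i * a ^+ (k - i)) = 0.
  apply: phi_inj; rewrite rmorph0 rmorph_sum; transitivity ((map_poly phi p).[x] * phi a ^+ k);
    last first.
    by rewrite (rootP px) mul0r.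
  rewrite horner_coef size_map_poly_id0 ?sp; last by rewrite (monicP p_mon) rmorph1 oner_eq0.
  rewrite mulr_suml; apply: eq_bigr => i _; rewrite coef_map !rmorphM !rmorphXn -E -mulrA.
  rewrite exprMn [_ ^+ i * _ ^+ i]mulrC -mulrA -exprD subnKC // -ltnS //.
have lc : p`_k = 1 by have := monicP p_mon; rewrite lead_coefE sp.
rewrite big_ord_recr /= lc mul1r subnn mulr1 addrC => /eqP; rewrite addr_eq0 => /eqP bk.
have : a %| b ^+ k.
  rewrite bk dvdpNr; elim/big_ind: _ => [|u v|i _]; [exact: dvdp0|exact: dvdp_add|].
  by rewrite dvdp_mull // dvdp_mull // dvdp_exp // subn_gt0.
move=> ab; have : a %| 1.
  by rewrite -(Gauss_dvdpl _ (coprimep_expr k cop)) mul1r.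
rewrite dvdp1 => /size_poly1P [c c0 ac]; exists (b * (c^-1)%:P).
apply: (mulfI phia0); rewrite E -rmorphM.
by rewrite ac mulrCA -polyCM mulfV // mulr1.
Qed.

Lemma integral_exp (R K : comNzRingType) (f : {rmorphism R -> K}) x i :
  integralOver f x -> integralOver f (x ^+ i).
Proof.
move=> xi; elim: i => [|i IHi]; first exact: integral1.
by rewrite exprS; apply: integral_mul.
Qed.

Lemma integral_horner_map (R K : comNzRingType) (f : {rmorphism R -> K}) (p : {poly R}) x :
  integralOver f x -> integralOver f (map_poly f p).[x].
Proof.
move=> xi; apply: integral_horner xi.
by apply/integral_poly => i; rewrite coef_map; apply: integral_id.
Qed.

Lemma integral_sum (R K : comNzRingType) (f : {rmorphism R -> K}) (I : Type) (r : seq I)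
  (Q : pred I) (G : I -> K) :
  (forall i, Q i -> integralOver f (G i)) -> integralOver f (\sum_(i <- r | Q i) G i).
Proof.
move=> Gi; elim/big_rec: _ => [|i x Qi xi]; first exact: integral0.
by apply: integral_add => //; apply: Gi.
Qed.

Lemma integral_det (R K : comNzRingType) (f : {rmorphism R -> K}) r (A : 'M[K]_r) :
  (forall i j, integralOver f (A i j)) -> integralOver f (\det A).
Proof.
move=> Ai; apply: integral_sum => s _; apply: integral_mul.
  by apply: integral_exp; apply: integral_opp; apply: integral1.
elim/big_rec: _ => [|i x _ xi]; first exact: integral1.
exact: integral_mul.
Qed.

Lemma integral_adj (R K : comNzRingType) (f : {rmorphism R -> K}) r (A : 'M[K]_r) i j :
  (forall i j, integralOver f (A i j)) -> integralOver f (\adj A i j).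
Proof.
move=> Ai; rewrite mxE; apply: integral_mul.
  by apply: integral_exp; apply: integral_opp; apply: integral1.
by apply: integral_det => i' j'; rewrite !mxE.
Qed.

Lemma poly_split_coef0 (R : nzRingType) (p : {poly R}) : exists p', p = p' * 'X + (p`_0)%:P.
Proof.
elim/poly_ind: p => [|p c _]; first by exists 0; rewrite mul0r add0r coef0.
by exists p; rewrite coefD coefMX coefC /= add0r.
Qed.

(** The power q^r with r = b mod a also fixes K. If r > 0, then X^(q^r) - X has q^a > q^r roots. *)
Lemma finField_exp_dvd (K : finFieldType) q a b : (1 < q)%N -> (0 < a)%N -> #|K| = (q ^ a)%N ->
  (forall x : K, x ^+ (q ^ b) = x) -> (a %| b)%N.
Proof.
move=> q_gt1 a_gt0 cK fixK; pose r := (b %% a)%N.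
have fixr (x : K) : x ^+ (q ^ r) = x.
  rewrite -[RHS]fixK (divn_eq b a) expnD exprM; congr (_ ^+ _).
  by elim: (b %/ a)%N => [|t IHt]; rewrite ?mul0n ?expn0 ?expr1 // mulSn expnD exprM -cK expf_card.
rewrite /dvdn -/r; apply: contraT; rewrite -lt0n => r_gt0.
have qr_gt1 : (1 < q ^ r)%N by rewrite -(exp1n r) ltn_exp2r.
have sz : size ('X^(q ^ r) - 'X : {poly K}) = (q ^ r).+1.
  by rewrite size_polyDl ?size_polyXn // size_polyN size_polyX ltnS.
have nz : 'X^(q ^ r) - 'X != 0 :> {poly K} by rewrite -size_poly_eq0 sz.
have := max_poly_roots nz _ (enum_uniq K); rewrite sz -cardE cK ltnS leq_exp2l //.
rewrite leqNgt ltn_mod a_gt0; apply.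
by apply/allP => x _; rewrite rootE !hornerE fixr subrr.
Qed.

Section CyclotomicRing.
Variables (F : finFieldType) (L : closedFieldType) (phi : {rmorphism {poly F} -> L}).
Hypothesis phi_inj : injective phi.
Variables (P M : {poly F}) (PI : monic_irreducible_poly P) (MI : monic_irreducible_poly M).
Hypothesis nPM : ~~ (P %| M).
Local Notation q := #|F|.
Local Notation n := (size M).-1.
Local Notation m := (q ^ n).-1.
Hypothesis primitive : forall j, M %| P ^+ j - 1 -> (m %| j)%N.
Variable lam : L.
Hypothesis lam_root : root (map_poly phi (carlitz_cyclo M)) lam.

Lemma phi_eq0 a : (phi a == 0) = (a == 0).
Proof. by rewrite -(rmorph0 phi) (inj_eq phi_inj). Qed.

(** Elements of F[t][lam] are handled through polynomials of size at most [m], which represent them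
    uniquely by [ev_inj]. *)
Definition ev (h : {poly {poly F}}) : L := (map_poly phi h).[lam].

Fact ev_is_zmod_morphism : zmod_morphism ev.
Proof. by move=> h h'; rewrite /ev rmorphB /= hornerD hornerN. Qed.

Fact ev_is_monoid_morphism : monoid_morphism ev.
Proof. by split=> [|h h']; rewrite /ev ?rmorph1 ?hornerC // rmorphM /= hornerM. Qed.

HB.instance Definition _ := GRing.isZmodMorphism.Build {poly {poly F}} L ev ev_is_zmod_morphism.
HB.instance Definition _ := GRing.isMonoidMorphism.Build {poly {poly F}} L ev ev_is_monoid_morphism.

Lemma evE h : ev h = (map_poly phi h).[lam].
Proof. by []. Qed.

Lemma evC c : ev c%:P = phi c.
Proof. by rewrite evE map_polyC hornerC. Qed.

Lemma evX : ev 'X = lam.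
Proof. by rewrite evE map_polyX hornerX. Qed.

Lemma evZ c h : ev (c *: h) = phi c * ev h.
Proof. by rewrite -mul_polyC rmorphM /= evC. Qed.

Lemma ev_cyclo : ev (carlitz_cyclo M) = 0.
Proof. exact/rootP. Qed.

Lemma integral_lam : integralOver phi lam.
Proof. by exists (carlitz_cyclo M); first exact: carlitz_cyclo_monic. Qed.

Lemma integral_ev h : integralOver phi (ev h).
Proof.
rewrite evE; apply: integral_horner integral_lam.
by apply/integral_poly => i; rewrite coef_map; apply: integral_id.
Qed.

(** An integral inverse of Q would lie in F[t], as F[t] is integrally closed. *)
Lemma irr_not_inv (Q : {poly F}) x : irreducible_poly Q -> integralOver phi x -> phi Q * x <> 1.
Proof.
move=> QI xint E; have [|c xE] := integrally_closed_poly (b := 1) phi_inj (irredp_neq0 QI) xint.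
  by rewrite rmorph1.
move: E; rewrite xE -rmorphM -(rmorph1 phi) => /phi_inj Qc.
have : Q %| 1 by rewrite -Qc dvdp_mulr.
by rewrite dvdp1; case: QI => /gtn_eqF ->.
Qed.

(** If f is nonzero modulo P, the Bezout relation at [lam] becomes 1 + P w = 0 and makes P
    invertible. Otherwise f is divided by P, which lowers the degree of its leading coefficient. *)
Lemma ev_eq0 (f : {poly {poly F}}) : (size f <= m)%N -> ev f = 0 -> f = 0.
Proof.
move=> sf fl; apply/eqP; apply: contraT => f0.
have [N] := ubnP (size (lead_coef f)); elim: N f sf fl f0 => // N IHN f sf fl f0 le_N.
have [fP|nfP] := boolP (map_poly (resid PI) f == 0); last first.
  have [u [v [w E]]] := carlitz_cyclo_bezout MI primitive nPM sf nfP.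
  have := congr1 ev E; rewrite !rmorphD !rmorphM /= fl ev_cyclo !mulr0 addr0 rmorph1 evZ =>
    /esym/eqP.
  rewrite addrC addr_eq0 => /eqP E1; exfalso; apply: (irr_not_inv PI.1 (integral_ev (- w))).
  by rewrite rmorphN mulrN E1 opprK.
pose f' := \poly_(i < size f) (f`_i %/ P).
have ff' : f = P *: f'.
  apply/polyP => i; rewrite coefZ coef_poly; case: ltnP => [_|le_i];
    last by rewrite mulr0 nth_default.
  by rewrite mulrC divpK // -(resid_eq0 PI) -coef_map (eqP fP) coef0.
have P0 : P != 0 := irredp_neq0 PI.1.
have f'0 : f' != 0 by apply: contraNneq f0 => f'0; rewrite ff' f'0 scaler0.
have sf' : size f' = size f by rewrite [in RHS]ff' size_scale.
apply: (IHN f') => //; rewrite ?sf' //.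
  by apply/eqP; move/eqP: fl; rewrite {1}ff' evZ mulf_eq0 phi_eq0 (negbTE P0).
move: le_N; rewrite {1}ff' lead_coefZ size_mul ?lead_coef_eq0 //.
have := PI.1.1; have : (0 < size (lead_coef f'))%N by rewrite size_poly_gt0 lead_coef_eq0.
by move: (size P) (size (lead_coef f')) => a b; lia.
Qed.

Lemma ev_mod h : exists2 h' : {poly {poly F}}, (size h' <= m)%N & ev h = ev h' /\ exists s, h = s *
  carlitz_cyclo M + h'.
Proof.
have mon := carlitz_cyclo_monic MI.
exists (Pdiv.Ring.rmodp h (carlitz_cyclo M)).
  by rewrite -ltnS -(size_carlitz_cyclo MI) Pdiv.Ring.ltn_rmodpN0 ?monic_neq0.
have E := Pdiv.RingMonic.rdivp_eq mon h; split;
  last by exists (Pdiv.Ring.rdivp h (carlitz_cyclo M)).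
by rewrite {1}E rmorphD rmorphM /= ev_cyclo mulr0 add0r.
Qed.

Lemma ev_dvd f : ev f = 0 -> exists s, f = s * carlitz_cyclo M.
Proof.
have [h' sh' [evh [s fE]]] := ev_mod f; rewrite evh => /(ev_eq0 sh') h'0.
by exists s; rewrite fE h'0 addr0.
Qed.

Lemma ev_inj (f h : {poly {poly F}}) : (size f <= m)%N -> (size h <= m)%N -> ev f = ev h -> f = h.
Proof.
move=> sf sh E; apply/eqP; rewrite -subr_eq0; apply/eqP/ev_eq0.
  by rewrite (leq_trans (size_polyD _ _)) // size_polyN geq_max sf.
by rewrite rmorphB /= E subrr.
Qed.

Lemma lam_neq0 : lam != 0.
Proof.
apply/eqP => l0; have := ev_cyclo; rewrite evE l0 -(rmorph0 phi) horner_map horner_coef0.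
rewrite (carlitz_cyclo_coef0 MI) => /eqP; rewrite (inj_eq phi_inj) => /eqP M0.
by have := irredp_neq0 MI.1; rewrite M0 eqxx.
Qed.

Lemma carlitz_actP a x : carlitz phi a x = carlitz_act phi a x.
Proof. by []. Qed.

Lemma torsion_lam : carlitz_act phi M lam = 0.
Proof. by rewrite -carlitz_cyclo_act (rootP lam_root) mulr0. Qed.

(** * Torsion points, the conjugates of [lam] *)

Lemma size_lt_M (a : {poly_n F}) : (size (val a) < size M)%N.
Proof.
apply: leq_ltn_trans (size_npoly a) _.
by rewrite ltn_predL size_poly_gt0; apply: irredp_neq0 MI.1.
Qed.

(** The points rho_a(lam) for nonzero a of degree less than n; by [mem_tors] they exhaust the
    nonzero M-torsion. *)
Definition tors : seq L := [seq carlitz_act phi (val a) lam | a <- enum {: {poly_n F}} & val a !=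
  0].

Lemma size_tors : size tors = m.
Proof.
rewrite size_map size_filter;
  have := count_predC (fun a : {poly_n F} => val a != 0) (enum {: {poly_n F}}).
rewrite -cardE card_npoly => <-.
rewrite (_ : count (predC _) _ = 1%N) ?addn1 //.
rewrite (eq_count (a2 := pred1 (0 : {poly_n F}))); last by move=> a; rewrite /= negbK -val_eqE.
by rewrite count_uniq_mem ?enum_uniq // mem_enum.
Qed.

Lemma tors_torsion x : x \in tors -> carlitz_act phi M x = 0 /\ x != 0.
Proof.
case/mapP => a; rewrite mem_filter => /andP[a0 _] ->; split.
  by rewrite -carlitz_actM mulrC carlitz_actM torsion_lam carlitz_act0.
apply/eqP => al; have Ma := carlitz_annihilator MI lam_neq0 torsion_lam al.
by move: (dvdp_leq a0 Ma); rewrite leqNgt size_lt_M.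
Qed.

Lemma uniq_tors : uniq tors.
Proof.
rewrite map_inj_in_uniq; first by apply: filter_uniq; apply: enum_uniq.
move=> a b _ _ E; apply/val_inj/eqP; rewrite -subr_eq0; apply: contraT => ab0.
have : M %| val a - val b.
  by apply: (carlitz_annihilator MI lam_neq0 torsion_lam); rewrite carlitz_act_polyB E subrr.
move/dvdp_leq => /(_ ab0); rewrite leqNgt => /negP[].
by rewrite (leq_ltn_trans (size_polyD _ _)) // size_polyN gtn_max !size_lt_M.
Qed.

Lemma cyclo_factor : map_poly phi (carlitz_cyclo M) = \prod_(x <- tors) ('X - x%:P).
Proof.
have mon : map_poly phi (carlitz_cyclo M) \is monic by rewrite monic_map ?carlitz_cyclo_monic.
rewrite [LHS](@all_roots_prod_XsubC _ (map_poly phi (carlitz_cyclo M)) tors).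
- by rewrite (monicP mon) scale1r.
- rewrite size_map_poly_id0 ?(size_carlitz_cyclo MI) ?size_tors //.
  by rewrite (monicP (carlitz_cyclo_monic MI)) rmorph1 oner_eq0.
- apply/allP => x /tors_torsion [Mx x0]; rewrite rootE -(mulrI_eq0 _ (mulfI x0)).
  by rewrite carlitz_cyclo_act Mx.
by rewrite uniq_rootsE uniq_tors.
Qed.

Lemma mem_tors x : carlitz_act phi M x = 0 -> x != 0 -> x \in tors.
Proof.
rewrite -carlitz_cyclo_act => /eqP; rewrite mulf_eq0 => /orP[->//|].
by rewrite cyclo_factor -/(root _ _) root_prod_XsubC.
Qed.

Lemma tors_ev x : x \in tors -> exists h, x = ev h.
Proof.
case/mapP => a _ ->; rewrite (carlitz_actE _ _ (leqnn _)).
exists (\sum_(i < size (val a)) carlitz_coef (val a) i *: 'X^(q ^ i)).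
by rewrite rmorph_sum; apply: eq_bigr => i _; rewrite /= evZ rmorphXn /= evX.
Qed.

(** This replaces Galois conjugation: a relation satisfied by [lam] is a multiple of the cyclotomic
    polynomial, so every torsion point satisfies it. *)
Lemma tors_root f x : ev f = 0 -> x \in tors -> (map_poly phi f).[x] = 0.
Proof.
case/ev_dvd => s -> xt; rewrite rmorphM /= hornerM cyclo_factor.
by rewrite [X in _ * X](_ : _ = 0) ?mulr0 //; apply/rootP; rewrite root_prod_XsubC.
Qed.


Lemma integral_tors x : x \in tors -> integralOver phi x.
Proof. by case/tors_ev => h ->; apply: integral_ev. Qed.

(** The constant coefficient of the cyclotomic polynomial is M, so its equation at x exhibits M as a
    multiple of x. *)
Lemma tors_dvd_M x : carlitz_act phi M x = 0 -> x != 0 -> exists2 w, integralOver phi w & x * w =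
  phi M.
Proof.
move=> Mx x0; have [p' pE] := poly_split_coef0 (carlitz_cyclo M).
have := carlitz_cyclo_act M phi x; rewrite Mx => /eqP; rewrite mulf_eq0 (negbTE x0) /=.
rewrite pE rmorphD rmorphM /= map_polyX map_polyC hornerD hornerMX hornerC.
rewrite (carlitz_cyclo_coef0 MI) addrC addr_eq0 => /eqP ->.
exists (- (map_poly phi p').[x]); last by rewrite mulrN mulrC.
by apply: integral_opp; apply: integral_horner_map; apply: integral_tors; apply: mem_tors.
Qed.

Definition tors_mx : 'M[L]_m := Vandermonde m (\row_(j < m) tors`_j).

Lemma tors_mxE i j : tors_mx i j = tors`_j ^+ i.
Proof. by rewrite !mxE. Qed.

Lemma nth_tors (j : 'I_m) : tors`_j \in tors.
Proof. by rewrite mem_nth // size_tors. Qed.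

Lemma integral_tors_mx i j : integralOver phi (tors_mx i j).
Proof. by rewrite tors_mxE; apply: integral_exp; apply: integral_tors; apply: nth_tors. Qed.

(** The Vandermonde factors are differences of distinct torsion points, hence nonzero torsion points
    themselves, and each of these divides M. *)
Lemma det_tors_mx_dvd : exists N w, integralOver phi w /\ \det tors_mx * w = phi M ^+ N.
Proof.
pose good x := exists N w, integralOver phi w /\ x * w = phi M ^+ N.
have good1 : good 1 by exists 0%N, 1; split; [exact: integral1 | rewrite mulr1].
have goodM x y : good x -> good y -> good (x * y).
  move=> [N [w [wi xw]]] [N' [w' [wi' yw']]]; exists (N + N')%N, (w * w'); split.
    exact: integral_mul.
  by rewrite mulrACA xw yw' exprD.
rewrite det_Vandermonde; apply: (big_ind good) => // i _; apply: (big_ind good) => // j lt_ij.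
rewrite !mxE; have [Mj j0] := tors_torsion (nth_tors j); have [Mi i0] := tors_torsion (nth_tors i).
have [||w wi E] := @tors_dvd_M (tors`_j - tors`_i).
- by rewrite carlitz_actB Mi Mj subrr.
- rewrite subr_eq0 nth_uniq ?size_tors ?uniq_tors //.
  by rewrite gtn_eqF.
by exists 1%N, w; rewrite expr1.
Qed.

Lemma det_tors_mx_neq0 : \det tors_mx != 0.
Proof.
have [N [w [_ E]]] := det_tors_mx_dvd; apply/eqP => V0; move: E.
rewrite V0 mul0r => /esym/eqP; rewrite expf_eq0 phi_eq0.
by rewrite (negbTE (irredp_neq0 MI.1)) andbF.
Qed.

(** * Integral elements of the cyclotomic function field *)

Lemma homogenize (p : {poly {poly F}}) k (h : {poly {poly F}}) a : p \is monic -> size p = k.+1 ->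
  a != 0 ->
  exists G, forall z, (map_poly phi G).[z] = phi a ^+ k * (map_poly phi p).[(map_poly phi h).[z] /
    phi a].
Proof.
move=> p_mon sp a0; have phia0 : phi a != 0 by rewrite phi_eq0.
exists (\sum_(i < k.+1) (p`_i * a ^+ (k - i)) *: h ^+ i) => z.
rewrite rmorph_sum /= horner_sum horner_coef size_map_poly_id0 ?sp; last first.
  by rewrite (monicP p_mon) rmorph1 oner_eq0.
rewrite mulr_sumr; apply: eq_bigr => i _.
rewrite map_polyZ hornerZ !rmorphXn /= horner_exp coef_map rmorphM rmorphXn /=.
have le_ik : (i <= k)%N by rewrite -ltnS.
rewrite expr_div_n -[in phi a ^+ k](subnK le_ik) exprD.
have : phi a ^+ i != 0 by rewrite expf_neq0.
move: (phi a ^+ i) (phi a ^+ (k - i)) (phi p`_i) => A B C A0.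
by field.
Qed.

(** The equation of x = ev(h) / a, cleared of denominators, is a polynomial relation for [lam], so
    it carries over to y. *)
Lemma integral_conj a h x : a != 0 -> integralOver phi x -> phi a * x = ev h ->
  forall y, y \in tors -> integralOver phi ((map_poly phi h).[y] / phi a).
Proof.
move=> a0 [p p_mon px] E y yt.
have [k sp] : exists k, size p = k.+1.
  by exists (size p).-1; rewrite prednK // size_poly_gt0 monic_neq0.
have phia0 : phi a != 0 by rewrite phi_eq0.
have [G GE] := homogenize h p_mon sp a0.
have G0 : ev G = 0.
  rewrite evE GE -evE -E [phi a * x]mulrC mulfK // (rootP px) mulr0.
  by [].
exists p => //; have := tors_root G0 yt; rewrite GE => /eqP.
by rewrite mulf_eq0 expf_eq0 (negbTE phia0) andbF.
Qed.

(* Cramer's rule for the conjugates of [x], whose Vandermonde determinant divides a power of [M]. *)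
Lemma integral_M_power a (h : {poly {poly F}}) x : a != 0 -> integralOver phi x ->
  phi a * x = ev h -> (size h <= m)%N ->
  exists N (h' : {poly {poly F}}), (size h' <= m)%N /\ phi M ^+ N * x = ev h'.
Proof.
move=> a0 xi E sh; have phia0 : phi a != 0 by rewrite phi_eq0.
have [N [w [wi Vw]]] := det_tors_mx_dvd.
pose X : 'rV[L]_m := \row_r ((map_poly phi h).[tors`_r] / phi a).
pose H : 'rV[L]_m := \row_i phi h`_i.
have HV : H *m tors_mx = phi a *: X.
  apply/rowP => r; rewrite !mxE mulrC divfK // (@horner_coef_wide _ m).
    by apply: eq_bigr => i _; rewrite coef_map !mxE.
  by rewrite (leq_trans (size_poly _ _)).
have /fin_all_exists [c cE] (i : 'I_m) : exists c, phi a * phi c = phi (M ^+ N * h`_i).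
  (* From [HV], multiplication by the adjugate and by w gives a s = M^N h_i. So s is both integral
     and a quotient of polynomials, hence a polynomial. *)
  pose s := (X *m \adj tors_mx) 0 i * w.
  have si : integralOver phi s.
    apply: integral_mul wi; rewrite mxE; apply: integral_sum => r _; apply: integral_mul.
      by rewrite mxE; apply: integral_conj a0 xi E _ (nth_tors r).
    exact: (integral_adj _ _ integral_tors_mx).
  have sE : phi a * s = phi (M ^+ N * h`_i).
    rewrite /s mulrA -[phi a * _]/(phi a * _) -[phi a * (X *m \adj tors_mx) 0 i](_ : (phi a *: X *m
      \adj tors_mx) 0 i = _).
      rewrite -HV -mulmxA mul_mx_adj mul_mx_scalar !mxE mulrAC Vw rmorphM rmorphXn //.
    by rewrite -scalemxAl mxE.
  have [d sd] := integrally_closed_poly phi_inj a0 si sE.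
  by exists d; rewrite -sd.
exists N, (\poly_(i < m) (if insub i is Some i' then c i' else 0)).
split; first exact: size_poly.
apply: (mulfI phia0); rewrite mulrCA E -rmorphXn -!evZ; congr ev.
apply/polyP => i; rewrite !coefZ coef_poly; case: ltnP => [lt_i|le_i]; last first.
  by rewrite nth_default ?mulr0 // (leq_trans sh).
by rewrite insubT /=; apply: phi_inj; rewrite [RHS]rmorphM cE.
Qed.

(** An Eisenstein argument. If M does not divide every coefficient of h, then lam^(m-1) / M is
    integral; together with lam^m = - M lo(lam) and lo(0) = 1 this makes [lam], and hence M,
    invertible among integral elements. *)
Lemma integral_div_M (h : {poly {poly F}}) y : integralOver phi y -> (size h <= m)%N ->
  phi M * y = ev h -> exists h' : {poly {poly F}}, (size h' <= m)%N /\ y = ev h'.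
Proof.
move=> yi sh E; have M0 : M != 0 := irredp_neq0 MI.1.
have phiM0 : phi M != 0 by rewrite phi_eq0.
suff dvdM j : (j < m)%N -> M %| h`_j.
  exists (\poly_(i < m) (h`_i %/ M)); split; first exact: size_poly.
  apply: (mulfI phiM0); rewrite E -evZ; congr ev.
  apply/polyP => i; rewrite coefZ coef_poly; case: ltnP => [lt_i|le_i].
    by rewrite mulrC divpK // dvdM.
  by rewrite mulr0 nth_default // (leq_trans sh).
elim/ltn_ind: j => j IHj lt_j; apply/negPn/negP => nMj.
have [lo cycloE [_ lo0]] := carlitz_cycloE MI.
have lam_m : lam ^+ m = - (phi M * ev lo).
  have := ev_cyclo; rewrite cycloE rmorphD rmorphXn /= evX evZ => /eqP.
  by rewrite addr_eq0 => /eqP.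
have mE : m = (m.-1 - j + j.+1)%N.
  by have := carlitz_cyclo_deg_gt0 MI; lia.
(* All coefficients before the j-th are divisible by M. After multiplication by lam^(m-1-j), the
   later terms contain lam^m, again a multiple of M, so only h_j lam^(m-1) remains modulo M. *)
pose h1 := \poly_(i < j) (h`_i %/ M); pose h2 := drop_poly j.+1 h.
have hE : h = M *: h1 + h`_j *: 'X^j + h2 * 'X^(j.+1).
  rewrite -[LHS](poly_take_drop j.+1); congr (_ + _); apply/polyP => i.
  rewrite coef_take_poly coefD !coefZ coef_poly coefXn ltnS leq_eqVlt.
  case: eqP => [->|ne] /=; first by rewrite ltnn mulr0 add0r mulr1.
  rewrite mulr0 addr0; case: ltnP => [lt_i|]; last by rewrite mulr0.
  by rewrite mulrC divpK // IHj // (ltn_trans lt_i).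
have [z1 z1i z1E] : exists2 z1, integralOver phi z1 & phi h`_j * lam ^+ m.-1 = phi M * z1.
  exists (y * lam ^+ (m.-1 - j) - ev h1 * lam ^+ (m.-1 - j) + ev lo * ev h2).
    have li := integral_lam; have := @integral_exp _ _ phi lam (m.-1 - j) li => lii.
    apply: integral_add; last by apply: integral_mul; apply: integral_ev.
    by apply: integral_sub; apply: integral_mul => //; apply: integral_ev.
  have Ey : phi M * y = phi M * ev h1 + phi h`_j * lam ^+ j + ev h2 * lam ^+ j.+1.
    by rewrite E {1}hE !rmorphD rmorphM /= !evZ !rmorphXn /= evX.
  have pw1 : lam ^+ m.-1 = lam ^+ j * lam ^+ (m.-1 - j).
    by rewrite -exprD subnKC // -ltnS prednK ?carlitz_cyclo_deg_gt0.
  have pw2 : lam ^+ j.+1 * lam ^+ (m.-1 - j) = - (phi M * ev lo).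
    by rewrite -exprD addnC -mE.
  rewrite pw1 mulrDr mulrBr [phi M * (y * _)]mulrA Ey.
  transitivity (phi h`_j * lam ^+ j * lam ^+ (m.-1 - j)
      + ev h2 * (lam ^+ j.+1 * lam ^+ (m.-1 - j)) + phi M * (ev lo * ev h2)).
    by rewrite pw2; ring.
  ring.
have cop : coprimep M h`_j by rewrite irreducible_poly_coprime //; exact: MI.1.
case/Bezout_eq1_coprimepP: cop => -[u v] /= uv.
pose z := phi u * lam ^+ m.-1 + phi v * z1.
have zi : integralOver phi z.
  apply: integral_add; apply: integral_mul => //; try exact: integral_id.
  by apply: integral_exp; apply: integral_lam.
have zE : lam ^+ m.-1 = phi M * z.
  rewrite -[LHS]mul1r -(rmorph1 phi) -uv rmorphD !rmorphM mulrDl -!mulrA z1E /z; ring.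
have [lo' loE] := poly_split_coef0 lo; rewrite lo0 in loE.
have lz : lam * z = - ev lo.
  apply: (mulfI phiM0); rewrite mulrCA -zE -exprS prednK ?carlitz_cyclo_deg_gt0 // lam_m; ring.
(* Since lam z = - lo(lam) and lo = lo' X + 1, this is an inverse of [lam]. *)
pose e := - z - ev lo'.
have ei : integralOver phi e.
  by apply: integral_sub; [apply: integral_opp | apply: integral_ev].
have le1 : lam * e = 1.
  rewrite /e mulrBr mulrN lz loE rmorphD rmorphM rmorph1 /= evX; ring.
have := irr_not_inv MI.1 (x := - (ev lo * e ^+ m)); apply.
  apply: integral_opp; apply: integral_mul; first exact: integral_ev.
  exact: integral_exp.
by rewrite mulrN mulrA -mulNr -lam_m -exprMn le1 expr1n.
Qed.

(** The denominator is first replaced by a power of M, whose factors are then removed one at a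
    time. *)
Lemma integral_fraction a (h : {poly {poly F}}) x : a != 0 -> integralOver phi x ->
  phi a * x = ev h -> exists2 h' : {poly {poly F}}, (size h' <= m)%N & x = ev h'.
Proof.
move=> a0 xi E; have [h1 sh1 [Eh1 _]] := ev_mod h; rewrite Eh1 in E.
have [N [h2 [sh2 E2]]] := integral_M_power a0 xi E sh1.
elim: N h2 sh2 E2 => [|N IHN] h2 sh2 E2.
  by exists h2 => //; rewrite -E2 expr0 mul1r.
have [||h3 [sh3 E3]] := @integral_div_M h2 (phi M ^+ N * x) _ sh2.
- by apply: integral_mul => //; apply: integral_exp; apply: integral_id.
- by rewrite mulrA -exprS.
exact: IHN sh3 E3.
Qed.

(** After cancelling powers of ev(h), its monic equation has a nonzero constant term, which is a
    multiple of ev(h). *)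
Lemma ev_inverse h : ev h != 0 -> exists (b : {poly F}) h', b != 0 /\ ev h * ev h' = phi b.
Proof.
move=> h0; have [p p_mon hp] := integral_ev h.
have [b [r [b0 E]]] : exists b r, b != 0 /\ ev h * (map_poly phi r).[ev h] = phi b.
  elim/poly_ind: p {p_mon} (monic_neq0 p_mon) hp => [|p c IHp] p0; first by rewrite eqxx in p0.
  have [c0|c0] := eqVneq c 0.
    rewrite c0 addr0 rmorphM rootE /= map_polyX hornerMX mulf_eq0 (negbTE h0) orbF.
    by apply: IHp; apply: contraNneq p0 => ->; rewrite c0 mul0r addr0.
  rewrite rmorphD rmorphM rootE /= map_polyX map_polyC hornerD hornerMX hornerC => E.
  exists c, (- p); split=> //; rewrite rmorphN hornerN /= mulrN mulrC.
  by apply/eqP; rewrite eqr_oppLR -addr_eq0.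
exists b, (r \Po h); split=> //; rewrite -E; congr (_ * _).
by rewrite evE map_comp_poly horner_comp.
Qed.

(** These quotients form a subfield containing F[t] and the torsion points. *)
Lemma in_cyclo_fraction x : in_cyclo phi M x -> exists a h, a != 0 /\ phi a * x = ev h.
Proof.
move/(_ (fun x => exists a h, a != 0 /\ phi a * x = ev h)); apply; first last.
- move=> l; rewrite carlitz_actP => Ml; have [->|l0] := eqVneq l 0.
    by exists 1, 0; rewrite oner_neq0 mulr0 rmorph0.
  have [h ->] := tors_ev (mem_tors Ml l0).
  by exists 1, h; rewrite oner_neq0 rmorph1 mul1r.
- by move=> a; exists 1, a%:P; rewrite oner_neq0 rmorph1 mul1r evC.
split; first by exists 1, 1; rewrite oner_neq0 !rmorph1 mulr1.
split=> [x1 y1 [a [h [a0 E]]] [b [k [b0 E']]]|].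
  exists (a * b), (b *: h - a *: k); rewrite mulf_neq0 //; split=> //.
  rewrite rmorphB /= !evZ -E -E' rmorphM; ring.
split=> [x1 y1 [a [h [a0 E]]] [b [k [b0 E']]]|x1 [a [h [a0 E]]]].
  exists (a * b), (h * k); rewrite mulf_neq0 //; split=> //.
  rewrite rmorphM rmorphM /= -E -E'; ring.
have [x0|x0] := eqVneq x1 0.
  by exists 1, 0; rewrite oner_neq0 x0 invr0 mulr0 rmorph0.
have phia0 : phi a != 0 by rewrite phi_eq0.
have evh0 : ev h != 0 by rewrite -E mulf_neq0.
have [b [h' [b0 E']]] := ev_inverse evh0.
exists b, (a *: h'); split=> //; rewrite evZ -E' -E; field.
by rewrite x0.
Qed.

Lemma in_cyclo_ev h : in_cyclo phi M (ev h).
Proof.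
move=> S [S1 [SB [SM SV]]] Sphi Stors.
have S0 : S 0 by rewrite -(subrr 1); apply: (SB).
have SD x y : S x -> S y -> S (x + y).
  by move=> Sx Sy; rewrite -[y]opprK -[- y]sub0r; apply: (SB) => //; apply: (SB).
elim/poly_ind: h => [|h c IHh]; first by rewrite rmorph0.
rewrite rmorphD rmorphM /= evX evC; apply: SD => //; apply: SM => //.
by apply: Stors; rewrite carlitz_actP torsion_lam.
Qed.

Lemma integral_overP x : integral_over_Fqt phi x <-> integralOver phi x.
Proof. by split=> [[p [p_mon px]]|[p p_mon px]]; exists p. Qed.

Lemma cyclo_ringP x :
  cyclo_ring phi M x <-> exists2 h : {poly {poly F}}, (size h <= m)%N & x = ev h.
Proof.
split=> [[/in_cyclo_fraction [a [h [a0 E]]] /integral_overP xi]|[h sh ->]].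
  exact: integral_fraction a0 xi E.
by split; [exact: in_cyclo_ev | apply/integral_overP/integral_ev].
Qed.

Lemma cyclo_ring_ev h : cyclo_ring phi M (ev h).
Proof. by apply/cyclo_ringP; have [h' sh' [-> _]] := ev_mod h; exists h'. Qed.


(** * The power basis and its discriminant *)

Lemma ev_sum (h : {poly {poly F}}) : (size h <= m)%N -> ev h = \sum_(i < m) phi h`_i * lam ^+ i.
Proof.
move=> sh; rewrite evE (@horner_coef_wide _ m) ?(leq_trans (size_poly _ _)) //.
by apply: eq_bigr => i _; rewrite coef_map.
Qed.

Lemma ev_rVpoly (a : 'I_m -> {poly F}) :
  ev (rVpoly (\row_i a i)) = \sum_(i < m) phi (a i) * lam ^+ i.
Proof. by rewrite ev_sum ?size_poly //; apply: eq_bigr => i _; rewrite coef_rVpoly_ord mxE. Qed.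

Lemma lam_basis_free (a : 'I_m -> {poly F}) :
  \sum_(i < m) phi (a i) * lam ^+ i = 0 -> forall i, a i = 0.
Proof.
rewrite -ev_rVpoly => E i.
have a0 : rVpoly (\row_i a i) = 0 by apply: ev_eq0 E; apply: size_poly.
by have := coef_rVpoly_ord (\row_i a i) i; rewrite a0 coef0 mxE.
Qed.

Lemma lam_basis_span x : cyclo_ring phi M x -> exists a : 'I_m -> {poly F},
  x = \sum_(i < m) phi (a i) * lam ^+ i.
Proof. by case/cyclo_ringP => h sh ->; exists (fun i : 'I_m => h`_i); apply: ev_sum. Qed.

Lemma cyclo_ring_lam i : cyclo_ring phi M (lam ^+ i).
Proof. by rewrite -evX -rmorphXn; apply: cyclo_ring_ev. Qed.

(** Its coefficients are the coordinates of lam^(i+j+k) in the power basis, as [disc_coprime]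
    requires. *)
Definition lam_struct (i j k : nat) : {poly {poly F}} :=
  Pdiv.Ring.rmodp 'X^(i + j + k) (carlitz_cyclo M).

Lemma size_lam_struct i j k : (size (lam_struct i j k) <= m)%N.
Proof.
by rewrite -ltnS -(size_carlitz_cyclo MI) Pdiv.Ring.ltn_rmodpN0 ?monic_neq0 ?carlitz_cyclo_monic.
Qed.

Lemma lam_struct_tors i j k y : y \in tors ->
  y ^+ (i + j + k) = \sum_(l < m) phi (lam_struct i j k)`_l * y ^+ l.
Proof.
move=> yt; have -> : y ^+ (i + j + k) = (map_poly phi 'X^(i + j + k)).[y].
  by rewrite map_polyXn hornerXn.
rewrite {1}(Pdiv.RingMonic.rdivp_eq (carlitz_cyclo_monic MI) 'X^(i + j + k)).
rewrite rmorphD rmorphM /= hornerD hornerM (tors_root ev_cyclo yt) mulr0 add0r.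
rewrite (@horner_coef_wide _ m) ?(leq_trans (size_poly _ _)) ?size_lam_struct //.
by apply: eq_bigr => l _; rewrite coef_map.
Qed.

Lemma lam_tors : lam \in tors.
Proof. exact: mem_tors torsion_lam lam_neq0. Qed.

(** The Vandermonde matrix V diagonalizes multiplication by lam^(i+j), so the trace is the sum of
    the (i+j)-th powers of the torsion points, and the trace matrix is V times its transpose. *)
Lemma trace_form_det (T : 'M[{poly F}]_m) :
  (forall i j, T i j = \sum_(k < m) (lam_struct i j k)`_k) -> phi (\det T) = \det tors_mx ^+ 2.
Proof.
move=> TE; have Vu : tors_mx \in unitmx by rewrite unitmxE unitfE det_tors_mx_neq0.
rewrite -det_map_mx expr2 -[X in _ = _ * X]det_tr -det_mulmx; congr (\det _).
apply/matrixP => i j; rewrite !mxE TE rmorph_sum.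
pose C := \matrix_(k < m, l < m) phi (lam_struct i j k)`_l.
pose D := diag_mx (\row_(r < m) tors`_r ^+ (i + j)).
have CV : C *m tors_mx = tors_mx *m D.
  apply/matrixP => k r; rewrite mul_mx_diag !mxE -exprD [(k + _)%N]addnC.
  rewrite (lam_struct_tors _ _ _ (nth_tors r)); apply: eq_bigr => l _.
  by rewrite !mxE.
transitivity (\tr C); first by apply: eq_bigr => k _; rewrite mxE.
rewrite -(mulmxK Vu C) CV mxtrace_mulC mulmxA mulVmx // mul1mx mxtrace_diag.
by apply: eq_bigr => r _; rewrite !mxE exprD.
Qed.

(** The discriminant is the square of the Vandermonde determinant and divides a power of M over the
    integral elements. The cofactor is a quotient of polynomials, so the divisibility holds in
    F[t]. *)
Lemma disc_coprime_cyclo g : (forall Q, irreducible_poly Q -> Q %| g -> ~~ (Q %| M)) ->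
  disc_coprime phi M g.
Proof.
move=> cop; exists m, (fun i => lam ^+ i); split; first by move=> i; apply: cyclo_ring_lam.
split; first exact: lam_basis_span.
split; first exact: lam_basis_free.
exists (fun i j k l => (lam_struct i j k)`_l); split.
  by move=> i j k; rewrite -!exprD (lam_struct_tors _ _ _ lam_tors).
move=> Q QI Qg; apply/negP; set T := \matrix_(i, j) _ => QT.
have TE : phi (\det T) = \det tors_mx ^+ 2 by apply: trace_form_det => i j; rewrite mxE.
have [N [w [wi Vw]]] := det_tors_mx_dvd.
have detT0 : \det T != 0 by rewrite -phi_eq0 TE expf_neq0 // det_tors_mx_neq0.
have E : phi (\det T) * w ^+ 2 = phi (M ^+ N ^+ 2) by rewrite TE -exprMn Vw !rmorphXn.
have [c cE] := integrally_closed_poly phi_inj detT0 (integral_exp 2 wi) E.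
move: E; rewrite cE -rmorphM => /phi_inj E.
have : Q %| M ^+ N ^+ 2 by rewrite -E dvdp_mulr.
have nQM := cop Q QI Qg; rewrite -exprM -irreducible_poly_coprime // in nQM *.
by apply/negP; rewrite -irreducible_poly_coprime // coprimep_expr.
Qed.


(** * The quotient of the ring of integers by [g] *)

Section Quotient.
Variables (g : {poly F}) (g0 : g != 0).
Local Notation O := (cyclo_ring phi M).
Local Notation D := (size g).-1.

Lemma cong_ev (h k : {poly {poly F}}) : (size h <= m)%N -> (size k <= m)%N ->
  cong O (phi g) (ev h) (ev k) <-> (forall i, g %| h`_i - k`_i).
Proof.
move=> sh sk; split=> [[z [/cyclo_ringP [l sl ->]]]|dvd].
  rewrite -rmorphB -evZ /= => /ev_inj E i; rewrite -coefB E ?coefZ ?dvdp_mulr //.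
    by rewrite (leq_trans (size_polyD _ _)) // size_polyN geq_max sh.
  exact: leq_trans (size_scale_leq _ _) sl.
exists (ev (\poly_(i < m) ((h`_i - k`_i) %/ g))); split; first exact: cyclo_ring_ev.
rewrite -rmorphB -evZ; congr ev; apply/polyP => i; rewrite coefB coefZ coef_poly.
case: ltnP => [lt_i|le_i]; first by rewrite mulrC divpK.
by rewrite mulr0 !nth_default ?subrr // (leq_trans _ le_i).
Qed.

(** In the power basis a class modulo g amounts to m residues modulo g. A list of representatives is
    compared with the vectors of remainders by injections in both directions. *)
Lemma quot_card_cyclo N : quot_card O (phi g) N -> N = (q ^ (D * m))%N.
Proof.
have sg : size g = D.+1 by rewrite prednK // size_poly_gt0.
case=> s [_ [sO [s_inj s_surj]]].
have /fin_all_exists2 [h sh hE] (i : 'I_N) :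
    exists2 h : {poly {poly F}}, (size h <= m)%N & s`_i = ev h by apply/cyclo_ringP/sO.
pose T := {ffun 'I_m -> {poly_D F}}.
have cT : #|{: T}| = (q ^ (D * m))%N by rewrite card_ffun card_npoly card_ord expnM.
pose x (t : T) : {poly {poly F}} := rVpoly (\row_i val (t i)).
have sx t : (size (x t) <= m)%N by apply: size_poly.
have xE t (i : 'I_m) : (x t)`_i = val (t i) by rewrite coef_rVpoly_ord mxE.
have /fin_all_exists [f fE] (t : T) : exists i : 'I_N, forall j, g %| (x t)`_j - (h i)`_j.
  have [i lt_i] := s_surj (ev (x t)) (cyclo_ring_ev _).
  rewrite (hE (Ordinal lt_i)) => /(cong_ev (sx t) (sh _)) H; by exists (Ordinal lt_i).
have f_inj : injective f.
  move=> t u E; apply/ffunP => i; apply/val_inj/eqP; rewrite -subr_eq0.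
  have : g %| val (t i) - val (u i).
    rewrite -!xE -[_ - _](subrKA (h (f t))`_i) dvdp_add ?fE //.
    by rewrite -opprB dvdpNr E fE.
  apply: contraTT => ne; apply/negP => /dvdp_leq => /(_ ne).
  rewrite leqNgt => /negP[]; apply: leq_ltn_trans (_ : _ <= D)%N _.
    by rewrite (leq_trans (size_polyD _ _)) // size_polyN geq_max !size_npoly.
  by rewrite ltn_predL size_poly_gt0.
pose y (i : 'I_N) : T := [ffun j : 'I_m => npolyp D ((h i)`_j %% g)].
have y_inj : injective y.
  move=> i j E; apply/eqP; apply: contraT => ne.
  have /s_inj : (i < N)%N := ltn_ord i; move/(_ j (ltn_ord j)).
  have neq : (i : nat) <> j by move=> ij; case/eqP: ne; apply: val_inj.
  move/(_ neq); rewrite !hE; case; apply/cong_ev => // l.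
  have [lt_l|le_l] := ltnP l m; last by rewrite !nth_default ?subrr ?dvdp0 // (leq_trans _ le_l).
  have := congr1 (fun t : T => val (t (Ordinal lt_l))) E; rewrite /y /= !ffunE !npolypK.
  - move=> El; rewrite (_ : _ - _ = ((h i)`_l %/ g - (h j)`_l %/ g) * g) ?dvdp_mull //.
    by rewrite [LHS](congr2 (fun a b => a - b) (divp_eq _ g) (divp_eq _ g)) El; ring.
  - by rewrite -ltnS -sg ltn_modp.
  - by rewrite -ltnS -sg ltn_modp.
apply/eqP; rewrite eqn_leq -{1}(card_ord N) -cT (leq_card _ y_inj) /=.
by rewrite -[X in (_ <= X)%N](card_ord N) (leq_card _ f_inj).
Qed.

Hypothesis Pg : P %| g.

(** If g divided 1, so would P. An element nonzero modulo P is inverted by the Bezout relation at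
    [lam], whose error term is a multiple of P, hence of g. *)
Lemma quot_is_field_cyclo : g %| P -> quot_is_field O (phi g).
Proof.
move=> gP; split=> [[z [[_ /integral_overP zi] E]]|x /cyclo_ringP [h sh ->] nx].
  have /dvdpP [u gE] := Pg; apply: (irr_not_inv PI.1 (x := phi u * z)).
    by apply: integral_mul => //; apply: integral_id.
  by rewrite mulrA -rmorphM [P * u]mulrC -gE -E subr0.
have nh : ~~ (map_poly (resid PI) h == 0).
  apply/negP => /eqP h0; apply: nx; rewrite -(rmorph0 ev); apply/cong_ev; rewrite ?size_poly0 //.
  move=> i; rewrite coef0 subr0; apply: dvdp_trans gP _.
  by rewrite -(resid_eq0 PI) -coef_map h0 coef0.
have [u [v [w E]]] := carlitz_cyclo_bezout MI primitive nPM sh nh.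
exists (ev u); split; first exact: cyclo_ring_ev.
have /dvdpP [c Pc] := gP.
exists (ev (c *: w)); split; first exact: cyclo_ring_ev.
have := congr1 ev E; rewrite !rmorphD !rmorphM /= ev_cyclo mulr0 addr0 rmorph1 mulrC => ->.
by rewrite addrC addKr !evZ mulrA -rmorphM [g * c]mulrC -Pc.
Qed.

(** The identity x^N = x passes to the residue field at P, which has q^(m deg P) elements; as N =
    q^(m D), m deg P divides m D. *)
Lemma carmichael_cyclo_dvd : carmichael_ideal O (phi g) -> ((size P).-1 %| D)%N.
Proof.
case=> N [/quot_card_cyclo NE [_ fixN]].
pose k := {poly %/ P with PI}.
have PhiI : monic_irreducible_poly (map_poly (resid PI) (carlitz_cyclo M)).
  by split; [exact: carlitz_cyclo_irr_mod | rewrite monic_map ?carlitz_cyclo_monic].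
pose K := {poly %/ _ with PhiI}.
have cK : #|{: K}| = (q ^ ((size P).-1 * m))%N.
  by rewrite card_qfpoly size_carlitz_cyclo_mod // card_qfpoly expnM.
have P_gt0 : (0 < (size P).-1)%N by have := PI.1.1; case: (size P) => [|[]].
have : ((size P).-1 * m %| D * m)%N.
  apply: (finField_exp_dvd (finNzRing_gt1 F)) cK _;
    first by rewrite muln_gt0 P_gt0 carlitz_cyclo_deg_gt0.
  move=> x; rewrite -NE.
  pose h : {poly {poly F}} := map_poly (val : k -> {poly F}) (val x).
  have hx : map_poly (resid PI) h = val x.
    rewrite -map_poly_comp_id0 ?resid_val //; last exact: rmorph0.
    by apply: map_poly_id => c _; rewrite /= resid_val.
  have [z [/cyclo_ringP [l sl ->]]] := fixN (ev h) (cyclo_ring_ev h).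
  rewrite -rmorphXn -rmorphB -evZ => /eqP; rewrite -subr_eq0 -rmorphB => /eqP /ev_dvd [s E].
  have {}E : h ^+ N = h + g *: l + s * carlitz_cyclo M.
    by rewrite -E; ring.
  have := congr1 (map_poly (resid PI)) E; rewrite rmorphXn !rmorphD rmorphM /= hx map_polyZ /=.
  have /eqP -> : resid PI g == 0 by rewrite resid_eq0.
  rewrite scale0r addr0 => /(congr1 (resid PhiI));
    rewrite rmorphXn rmorphD rmorphM /= resid_val => ->.
  have /eqP -> : resid PhiI (map_poly (resid PI) (carlitz_cyclo M)) == 0 by rewrite resid_eq0.
  by rewrite mulr0 addr0.
by rewrite dvdn_pmul2r ?carlitz_cyclo_deg_gt0.
Qed.

End Quotient.

End CyclotomicRing.

(** * The choice of the cyclotomic fields *)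

(** Expressing each family in the other gives matrices whose product is the identity of size n by
    freeness, which forces n <= m over a nonzero commutative ring. *)
Lemma basis_card_le (R L : comNzRingType) (phi : {rmorphism R -> L}) (O : L -> Prop) n m
  (b : 'I_n -> L) (b' : 'I_m -> L) :
  (forall i, O (b i)) -> (forall j, O (b' j)) ->
  (forall x, O x -> exists a : 'I_n -> R, x = \sum_(i < n) phi (a i) * b i) ->
  (forall x, O x -> exists a : 'I_m -> R, x = \sum_(j < m) phi (a j) * b' j) ->
  (forall a : 'I_n -> R, \sum_(i < n) phi (a i) * b i = 0 -> forall i, a i = 0) ->
  (n <= m)%N.
Proof.
move=> Ob Ob' span span' free.
have /fin_all_exists [B BE] (i : 'I_n) := span' _ (Ob i).
have /fin_all_exists [B' BE'] (j : 'I_m) := span _ (Ob' j).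
apply: (@mulmx1_min _ n m (\matrix_(i, j) B i j) (\matrix_(j, i) B' j i)).
apply/matrixP => i k; rewrite !mxE.
under eq_bigr => j _ do rewrite !mxE.
apply/eqP; rewrite -subr_eq0; apply/eqP.
apply: (free (fun l => \sum_(j < m) B i j * B' j l - (i == l)%:R)).
under eq_bigr => l _ do rewrite rmorphB rmorph_sum rmorph_nat mulrBl mulr_suml.
rewrite sumrB exchange_big /= [X in _ - X](bigD1 i) //= eqxx mul1r [X in _ - (_ + X)]big1 ?addr0;
  last first.
  by move=> l; rewrite eq_sym => /negbTE ->; rewrite mul0r.
rewrite [X in _ - X]BE; apply/eqP; rewrite subr_eq0; apply/eqP.
apply: eq_bigr => j _; rewrite [X in _ = _ * X]BE' mulr_sumr.
by apply: eq_bigr => l _; rewrite rmorphM mulrA.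
Qed.

(** * Irreducible factors of a non-Carmichael polynomial *)

Section Factors.
Variable F : finFieldType.
Local Notation q := #|F|.

Lemma monic_scale (p : {poly F}) : p != 0 -> (lead_coef p)^-1 *: p \is monic.
Proof. by move=> p0; rewrite monicE lead_coefZ mulVf // lead_coef_eq0. Qed.

Lemma irred_factor (p : {poly F}) : (1 < size p)%N ->
  exists2 P, monic_irreducible_poly P & P %| p.
Proof.
move=> p_gt1; have p0 : p != 0 by rewrite -size_poly_gt0 ltnW.
have lc0 : (lead_coef p)^-1 != 0 by rewrite invr_eq0 lead_coef_eq0.
have [|P [P_mon P_irr] Pp] := monic_irred_factor (monic_scale p0).
  by rewrite size_scale.
by exists P; [split | rewrite dvdpZr in Pp].
Qed.

(** An irreducible factor of the cofactor of gcd(g, h) in g divides h, hence also the gcd, so its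
    square divides g. *)
Lemma squarefree_dvdp (g h : {poly F}) : g != 0 -> squarefree_poly g ->
  (forall P, monic_irreducible_poly P -> P %| g -> P %| h) -> g %| h.
Proof.
move=> g0 sqf dvd; have /dvdpP [e gE] := dvdp_gcdl g h.
have e0 : e != 0 by apply: contraNneq g0 => e0; rewrite gE e0 mul0r.
have [e_gt1|e_le1] := ltnP 1 (size e).
  have [P PI Pe] := irred_factor e_gt1.
  have Pg : P %| g by rewrite gE dvdp_mulr.
  have Pc : P %| gcdp g h by rewrite dvdp_gcd Pg dvd.
  by case: (sqf P PI.1.1); rewrite gE dvdp_mul.
have /size_poly1P [c c0 ec] : size e == 1%N by rewrite eqn_leq e_le1 size_poly_gt0.
by rewrite gE ec mul_polyC dvdpZl // dvdp_gcdr.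
Qed.

Lemma quot_card_poly (g : {poly F}) : g != 0 ->
  quot_card (fun _ : {poly F} => True) g (q ^ (size g).-1).
Proof.
move=> g0; have lt_g (a : {poly F}) : (size a <= (size g).-1)%N -> (size a < size g)%N.
  by move=> le_a; apply: leq_ltn_trans le_a _; rewrite ltn_predL size_poly_gt0.
pose s : seq {poly F} := [seq val r | r <- enum {: {poly_(size g).-1 F}}].
have ss : size s = (q ^ (size g).-1)%N by rewrite size_map -cardE card_npoly.
have us : uniq s by rewrite map_inj_uniq ?enum_uniq //; apply: val_inj.
have sP (a : {poly F}) : (a \in s) = (size a <= (size g).-1)%N.
  apply/mapP/idP => [[r _ ->]|le_a]; first exact: size_npoly.
  by exists (NPoly le_a) => //; rewrite mem_enum.
exists s; split=> //; split=> //; split=> [i j lt_i lt_j neq [z [_ E]]|x _].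
  have lti : (size (s`_i)%R < size g)%N by apply: lt_g; rewrite -sP mem_nth // ss.
  have ltj : (size (s`_j)%R < size g)%N by apply: lt_g; rewrite -sP mem_nth // ss.
  have : s`_i - s`_j = 0.
    apply/eqP; apply: contraT => ne; have : g %| s`_i - s`_j by rewrite E dvdp_mulr.
    move/dvdp_leq => /(_ ne); rewrite leqNgt => /negP[].
    by rewrite (leq_ltn_trans (size_polyD _ _)) // size_polyN gtn_max lti.
  by move/eqP; rewrite subr_eq0 nth_uniq ?ss // => /eqP.
have xs : x %% g \in s by rewrite sP -ltnS prednK ?size_poly_gt0 // ltn_modp.
exists (index (x %% g) s); first by rewrite -ss index_mem.
rewrite nth_index //; exists (x %/ g); split=> //.
by rewrite {1}(divp_eq x g) addrK mulrC.
Qed.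

(** One direction of the analogue of Korselt's criterion: if deg P divides deg g, then x^(q^(deg g))
    = x modulo P, and square-freeness combines these congruences. *)
Lemma carmichael_of_degrees (g : {poly F}) : (1 < size g)%N -> squarefree_poly g ->
  ~ irreducible_poly g ->
  (forall P, monic_irreducible_poly P -> P %| g -> ((size P).-1 %| (size g).-1)%N) ->
  carmichael_poly g.
Proof.
move=> g_gt1 sqf nirr deg; have g0 : g != 0 by rewrite -size_poly_gt0 ltnW.
exists (q ^ (size g).-1)%N; split; first exact: quot_card_poly.
split=> [[_ inv]|x _].
  apply: nirr; split=> // a a1 ag; rewrite -dvdp_size_eqp //.
  have /dvdpP [b gE] := ag.
  have a0 : a != 0 by apply: contraNneq g0 => a0; rewrite gE a0 mulr0.
  have b0 : b != 0 by apply: contraNneq g0 => b0; rewrite gE b0 mul0r.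
  rewrite eqn_leq dvdp_leq //= leqNgt; apply/negP => lt_ag.
  (* A proper divisor a of g is nonzero modulo g; an inverse of it modulo g would make a divide
     1. *)
  have [||y [_ [z [_ E]]]] := inv a => //.
    case=> z [_]; rewrite subr0 => E.
    by have := dvdp_leq a0 (_ : g %| a); rewrite E dvdp_mulr // leqNgt -E lt_ag => /(_ isT).
  have : a %| 1.
    have -> : 1 = a * y - g * z by rewrite -E opprB addrC subrK.
    by rewrite dvdp_sub ?dvdp_mulr.
  by rewrite dvdp1 (negbTE a1).
have : g %| x ^+ (q ^ (size g).-1) - x; last first.
  by case/dvdpP => z E; exists z; rewrite mulrC.
apply: squarefree_dvdp => // P PI Pg.
rewrite -(resid_eq0 PI) rmorphB rmorphXn /= subr_eq0.
have /dvdnP [t ->] := deg P PI Pg.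
by elim: t => [|t IHt];
  rewrite ?mul0n ?expn0 ?expr1 // mulSn expnD exprM -(card_qfpoly PI) expf_card.
Qed.

Lemma non_carmichael_factor (g : {poly F}) : (1 < size g)%N -> squarefree_poly g -> ~
  carmichael_poly g ->
  exists P, [/\ monic_irreducible_poly P, P %| g & g %| P \/ ~~ ((size P).-1 %| (size g).-1)%N].
Proof.
move=> g_gt1 sqf ncarm; have g0 : g != 0 by rewrite -size_poly_gt0 ltnW.
have [/irreducibleP g_irr|nirr] := boolP (irreducibleb g).
  have [P PI Pg] := irred_factor g_gt1; exists P; split=> //; left.
  have : P %= g by apply: g_irr.2 => //; rewrite neq_ltn PI.1.1 orbT.
  by case/andP.
apply: NNPP => none; apply: ncarm; apply: carmichael_of_degrees => //.
  by move/irreducibleP; apply/negP.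
move=> P PI Pg; apply/negPn/negP => nd; apply: none; exists P; split=> //; by right.
Qed.

End Factors.

(** * Construction of infinitely many fields *)

Section Main.
Variables (F : finFieldType) (L : closedFieldType) (phi : {rmorphism {poly F} -> L}).
Hypothesis phi_inj : injective phi.
Variable g : {poly F}.
Hypotheses (g_gt1 : (1 < size g)%N) (sqf : squarefree_poly g) (ncarm : ~ carmichael_poly g).

(** The rank of the ring of integers over F[t] is an invariant of the field, and it serves to tell
    fields apart. *)
Definition has_cyclo_rank (M : {poly F}) (r : nat) : Prop := exists b : 'I_r -> L,
  [/\ forall i, cyclo_ring phi M (b i),
      forall x, cyclo_ring phi M x -> exists a : 'I_r -> {poly F}, x = \sum_(i < r) phi (a i) * b i
        &
      forall a : 'I_r -> {poly F}, \sum_(i < r) phi (a i) * b i = 0 -> forall i, a i = 0].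

Lemma same_cyclo_rank M N r t : same_cyclo phi M N ->
  has_cyclo_rank M r -> has_cyclo_rank N t -> r = t.
Proof.
move=> same [b [Ob sb fb]] [c [Oc sc fc]].
have sameO x : cyclo_ring phi M x <-> cyclo_ring phi N x.
  by split=> -[xM xi]; split=> //; apply/same.
apply/eqP; rewrite eqn_leq; apply/andP; split.
  apply: (@basis_card_le _ _ phi (cyclo_ring phi M) _ _ b c) => // [j|x /sameO]; last exact: sc.
  exact/sameO.
apply: (@basis_card_le _ _ phi (cyclo_ring phi N) _ _ c b) => // [j|x /sameO]; last exact: sb.
exact/sameO.
Qed.

Lemma good_cyclo (B : nat) : exists M : {poly F},
  [/\ (B < size M)%N, (1 < size M)%N, has_cyclo_rank M (#|F| ^ (size M).-1).-1,
      disc_coprime phi M g & ~ carmichael_in_cyclo phi M (phi g)].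
Proof.
have g0 : g != 0 by rewrite -size_poly_gt0 ltnW.
have [P [PI Pg Palt]] := non_carmichael_factor g_gt1 sqf ncarm.
(* The summand [size g] makes deg M exceed deg g, so the irreducible M shares no factor with g. *)
have [M [MI]] := artin_primitive_root PI (B + size g).
move=> lt_BM prim; have lt_gM : (size g < size M)%N by apply: leq_ltn_trans lt_BM; rewrite leq_addl.
have ndvdM Q : irreducible_poly Q -> Q %| g -> ~~ (Q %| M).
  move=> QI Qg; apply/negP => QM.
  have : Q %= M by apply: MI.1.2 => //; rewrite neq_ltn QI.1 orbT.
  by move/eqp_size => sQ; move: (dvdp_leq g0 Qg); rewrite sQ leqNgt lt_gM.
have nPM := ndvdM P PI.1 Pg.
have [lam lamr] : {lam | root (map_poly phi (carlitz_cyclo M)) lam}.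
  apply/sigW/closed_rootP; rewrite size_map_poly_id0 ?size_carlitz_cyclo //.
    by rewrite eqSS -lt0n carlitz_cyclo_deg_gt0.
  by rewrite (monicP (carlitz_cyclo_monic MI)) rmorph1 oner_eq0.
exists M; split.
- by apply: leq_ltn_trans lt_BM; rewrite leq_addr.
- exact: MI.1.1.
- exists (fun i => lam ^+ i); split.
  + by move=> i; apply: (cyclo_ring_lam phi_inj PI MI nPM prim lamr).
  + exact: (lam_basis_span phi_inj PI MI nPM prim lamr).
  + exact: (lam_basis_free phi_inj PI MI nPM prim lamr).
- exact: (disc_coprime_cyclo phi_inj PI MI nPM prim lamr).
case=> _ carm; case: Palt => [gP|].
  by case: carm => N [_ [nf _]]; apply: nf;
    apply: (quot_is_field_cyclo phi_inj PI MI nPM prim lamr).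
by apply/negP/negPn; apply: (carmichael_cyclo_dvd phi_inj PI MI nPM prim lamr g0 Pg carm).
Qed.

End Main.

(** Infinitude is expressed by avoiding an arbitrary finite list, with equality of fields in place
    of equality of the polynomials M. *)
Theorem theorem5p8 (F : finFieldType) (L : closedFieldType)
  (phi : {rmorphism {poly F} -> L}) (phi_inj : injective phi)
  (g : {poly F}) :
  (1 < size g)%N -> squarefree_poly g -> ~ carmichael_poly g ->
  forall s : seq {poly F},
    exists M : {poly F},
      (1 < size M)%N /\
      (forall N, N \in s -> ~ same_cyclo phi M N) /\
      disc_coprime phi M g /\
      ~ carmichael_in_cyclo phi M (phi g).
Proof.
move=> g_gt1 sqf ncarm s.
(* The size bound and the rank are added for the induction on the list. *)
suff H B : exists M : {poly F}, [/\ (B < size M)%N, (1 < size M)%N,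
    has_cyclo_rank phi M (#|F| ^ (size M).-1).-1,
    forall N, N \in s -> ~ same_cyclo phi M N &
    disc_coprime phi M g /\ ~ carmichael_in_cyclo phi M (phi g)].
  by have [M [_ ? _ ? [? ?]]] := H 0%N; exists M.
elim: s B => [|N s IHs] B.
  by have [M [? ? ? ? ?]] := good_cyclo phi_inj g_gt1 sqf ncarm B; exists M.
have [M [BM M_gt1 Mrank Ms Mg]] := IHs B.
have [same|nsame] := classic (same_cyclo phi M N); last first.
  by exists M; split=> // N'; rewrite inE => /orP[/eqP->//|/Ms].
(* If M defines the field of N, a larger M' avoids it: otherwise M and M' would define the same
   field, although their ranks q^n - 1 differ. *)
have [M' [MM' M'_gt1 M'rank M's M'g]] := IHs (size M).
exists M'; split=> //; first exact: ltn_trans BM MM'.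
move=> N'; rewrite inE => /orP[/eqP-> same'|/M's //].
have sameMM' : same_cyclo phi M M' by move=> x; split=> [/same/same'|/same'/same].
have := same_cyclo_rank sameMM' Mrank M'rank.
have q_gt1 := finNzRing_gt1 F; have q_gt0 e : (0 < #|F| ^ e)%N by rewrite expn_gt0 ltnW.
move/(congr1 S); rewrite !prednK // => /eqP; rewrite eqn_exp2l //.
by move: MM' M_gt1; case: (size M) (size M') => [|a] [|b] //= lt_ab _ /eqP ab;
  rewrite ab ltnn in lt_ab.
Qed.
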